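(* Let $f,g:\hat{\mathbb C}\to\hat{\mathbb C}$ be arbitrary nonidentity Möbius transformations. The following four statements are equivalent: (i) $f$ and $g$ are topologically conjugate; (ii) $\operatorname{tr} M_f\notin[-2,2]$ and $\operatorname{tr} M_g\notin [-2,2]$, or $\operatorname{tr} M_f=\pm\operatorname{tr} M_g$ (here $[-2,2]$ is the set of all $a\in\mathbb R$ satisfying $-2\le a\le 2$); (iii) if $\lambda$ is any eigenvalue of $M_f$ and $\lambda'$ is any eigenvalue of $M_g$, then ($|\lambda|\ne 1$ and $|\lambda'|\ne 1$), or $\lambda=\pm\lambda'$, or $\lambda=\pm\bar{\lambda'}$; (iv) if $\mu$ is any multiplier of $f$ and $\nu$ is any multiplier of $g$, then ($|\mu|\ne 1$ and $|\nu|\ne 1$), or $\mu=\nu$, or $\mu=\bar\nu$.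
   Context: $\hat{\mathbb C}=\mathbb C\cup\{\infty\}$ is the extended complex plane (Riemann sphere). A Möbius transformation is a map $f:\hat{\mathbb C}\to\hat{\mathbb C}$ of the form $f(z)=\frac{az+b}{cz+d}$ with $a,b,c,d\in\mathbb C$, $ad-bc\neq 0$. To $f$ one assigns the matrix $$M_f:=\frac{1}{\sqrt{ad-bc}}\begin{bmatrix} a&b\\ c&d\end{bmatrix},$$ which has determinant $1$ and is determined by $f$ uniquely up to multiplication by $-1$; $\operatorname{tr}$ denotes the trace. Conditions involving $M_f$, $M_g$ do not depend on the choice of sign. Two Möbius transformations $f,g$ are conjugate if $g=h^{-1}fh$ for some Möbius transformation $h$; they are topologically conjugate if $g=h^{-1}fh$ for some homeomorphism $h:\hat{\mathbb C}\to\hat{\mathbb C}$ (a bijection with $h$ and $h^{-1}$ continuous). Multipliers: each nonidentity Möbius transformation $f$ is conjugate to exactly one Möbius transformation of the form $m_\mu(z)=\mu z$ ($\mu\in\mathbb C$, $\mu\ne 0,1$) or $m_1(z)=z+1$ (in which case $\mu:=1$), where $\mu$ is determined up to replacement by $1/\mu$. The numbers $\mu$ and $1/\mu$ are called the multipliers of $f$. *)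

(* Defs.v *)
From HB Require Import structures.
From mathcomp Require Import all_boot all_order all_algebra.
From mathcomp Require Import all_classical all_reals all_analysis.
From mathcomp Require Export complex.

Set Implicit Arguments.
Unset Strict Implicit.
Unset Printing Implicit Defensive.

Import Order.TTheory GRing.Theory Num.Theory.
Import numFieldNormedType.Exports.

Local Open Scope ring_scope.

(* The extended plane over C; [None] is the point at infinity.  The topology
   of C is the one induced by its norm. *)
Notation sphere C := (one_point_compactification C).

Section Mobius.
Variable C : numClosedFieldType.
Implicit Types (f g h : sphere C -> sphere C) (A M : 'M[C]_2) (mu nu : C).

(* z |-> (a z + b) / (c z + d) for A = [a b; c d], with f(oo) = a / c
   (oo if c = 0) and f(z) = oo if c z + d = 0. *)
Definition mobius A (z : sphere C) : sphere C :=
  match z with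
  | Some w => let den := A 1 0 * w + A 1 1 in
              if den == 0 then None else Some ((A 0 0 * w + A 0 1) / den)
  | None => if A 1 0 == 0 then None else Some (A 0 0 / A 1 0)
  end.

Definition is_mobius f := exists A, \det A != 0 /\ f = mobius A.

(* M is one of the two possible choices of M_f.  Both signs are obtained from
   the principal root [sqrtC], since A and - A represent the same map and have
   the same determinant. *)
Definition mobius_matrix f M :=
  exists A, [/\ \det A != 0, f = mobius A & M = (sqrtC (\det A))^-1 *: A].

Definition homeomorphic_inverses (h h' : sphere C -> sphere C) :=
  [/\ cancel h h', cancel h' h, continuous h & continuous h'].

Definition topologically_conjugate f g :=
  exists h h', homeomorphic_inverses h h' /\ g = h' \o f \o h.

Definition mobius_conjugate f g :=
  exists h h', [/\ is_mobius h, cancel h h', cancel h' h & g = h' \o f \o h].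

Definition model_map mu : sphere C -> sphere C :=
  omap (fun w : C => if mu == 1 then w + 1 else mu * w).

Definition multiplier f mu :=
  exists nu, [/\ nu != 0, mobius_conjugate f (model_map nu)
               & mu = nu \/ mu = nu^-1].

End Mobius.

(* Main.v *)
Require Import Defs.
From mathcomp Require Import all_boot all_order all_algebra.
From mathcomp Require Import all_classical all_reals all_analysis.
From mathcomp Require Import ring lra zify.
Import Order.TTheory GRing.Theory Num.Theory.
Import numFieldNormedType.Exports.
Local Open Scope classical_set_scope.
Local Open Scope ring_scope.

(** Everything reduces to the normal forms z |-> mu z and z |-> z + 1.  Since
    t = tr M_f satisfies (mu + 1)^2 = mu t^2 and the eigenvalues l satisfy
    l^2 - t l + 1 = 0, the multipliers are the squares of the eigenvalues, and
    l is unimodular iff t lies in [-2, 2]; this gives (ii) -> (iii) -> (iv).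
    For (iv) -> (i), two multiplications by non-unimodular numbers are
    conjugate by a spiral z |-> z exp(w log|z|).  For (i) -> (ii), let h be a
    homeomorphism of the punctured plane with h(nu z) = mu h(z), |nu| = 1.  It
    lifts through exp to H with H(z + 2 pi i) = H(z) + 2 pi i d; lifting the
    inverse of h as well gives d = 1 or d = -1.  If nu = exp a, then
    H(z + a) = H(z) + c with exp c = mu; as H(z) - d z is bounded on the
    imaginary axis, c = d a, that is mu = nu or mu = 1/nu. *)

Set Implicit Arguments.
Unset Strict Implicit.
Unset Printing Implicit Defensive.

(** The obstacle is that a topological conjugacy [h] is merely continuous, so multipliers, which are
    derivatives at fixed points, are not visibly preserved. The number of fixed points tells the
    translation from the multiplications. For two multiplications [h] permutes 0 and infinity, and
    the inversion z |-> 1/z undoes a swap. What remains is a homeomorphism of the punctured plane,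
    whose degree d around the puncture replaces the derivative. Only one of the two multipliers has
    to be assumed unimodular: c = d a is purely imaginary, so the other multiplier exp c is
    unimodular as well.

    The alternatives mu = 1/nu and mu = conj nu agree on the unit circle. The first one comes from
    swapping the fixed points or from d = -1, the second one from complex conjugation, a
    homeomorphism of the sphere that reverses orientation.

    The lifts are built by hand. They need a logarithm on the right half-plane only, because the
    ratio of two sufficiently close values of a nonvanishing continuous function lies there. *)

(* R[i] has no topology of its own; as a numClosedFieldType it gets the norm
   topology that the definition of the sphere refers to. *)
Definition Cx (R : realType) : numClosedFieldType := R[i].

(** * The complex exponential and logarithm *)

Section ComplexPlane.
Variable R : realType.
Local Notation C := (Cx R).
Local Notation Re := (@complex.Re R).
Local Notation Im := (@complex.Im R).
Implicit Types (z w : C) (x y : R).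

Definition cplx x y : C := Complex x y.

Definition cmod z : R := Num.sqrt (Re z ^+ 2 + Im z ^+ 2).

Lemma normE z : `|z| = (cmod z)%:C%C.
Proof. exact: normc_def. Qed.

Lemma cplxE z : z = cplx (Re z) (Im z).
Proof. by case: z. Qed.

Lemma ReB z w : Re (z - w) = Re z - Re w.
Proof. by case: z w => [? ?] [? ?]. Qed.

Lemma ImB z w : Im (z - w) = Im z - Im w.
Proof. by case: z w => [? ?] [? ?]. Qed.

Lemma cmod_ge0 z : 0 <= cmod z.
Proof. exact: sqrtr_ge0. Qed.

Lemma cmod_eq0 z : (cmod z == 0) = (z == 0).
Proof. by rewrite -[RHS]normr_eq0 normE eq_complex /= eqxx andbT. Qed.

Lemma cmod_gt0 z : (0 < cmod z) = (z != 0).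
Proof. by rewrite lt_def cmod_eq0 cmod_ge0 andbT. Qed.

Lemma cmodM z w : cmod (z * w) = cmod z * cmod w.
Proof. by apply: complexI; have := normrM z w; rewrite !normE => ->;
  rewrite rmorphM. Qed.

Lemma cmod1 : cmod 1 = 1.
Proof. by apply: complexI; have := normr1 C; rewrite normE. Qed.

Lemma cmodV z : cmod z^-1 = (cmod z)^-1.
Proof. by apply: complexI; have := normfV z; rewrite !normE => ->;
  rewrite fmorphV. Qed.

Lemma norm_eq1 z : (`|z| == 1) = (cmod z == 1).
Proof. by rewrite normE eq_complex /= eqxx andbT. Qed.

Lemma Re_le_cmod z : `|Re z| <= cmod z.
Proof. by rewrite -lecR -normE; exact: normc_ge_Re. Qed.

Lemma Im_le_cmod z : `|Im z| <= cmod z.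
Proof. by rewrite -sqrtr_sqr ler_sqrt ?lerDr ?addr_ge0 ?sqr_ge0. Qed.

Lemma cmod_le z : cmod z <= `|Re z| + `|Im z|.
Proof.
rewrite -[leRHS]ger0_norm ?addr_ge0 // -sqrtr_sqr ler_sqrt ?sqr_ge0 //.
by rewrite sqrrD !real_normK ?num_real // addrAC lerDl mulrn_wge0 ?mulr_ge0.
Qed.

Lemma near_cmod z e : 0 < e -> \forall w \near nbhs z, cmod (z - w) < e.
Proof.
move=> e0; have e0' : 0 < e%:C%C :> C by rewrite ltcR.
apply: filterS (@nbhsx_ballx _ C z _ e0') => w.
by rewrite /ball /= normE ltcR.
Qed.

Lemma cvg_cmodP (T : Type) (F : set_system T) (FF : Filter F) (f : T -> C) z :
  (forall e, 0 < e -> \forall t \near F, cmod (z - f t) < e) -> f @ F --> z.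
Proof.
move=> H; apply/(@cvgrPdist_lt _ C) => e e0.
have [d d0 ed] : exists2 d, 0 < d & e = d%:C%C.
  exists (Re e).
    by move: e0; rewrite ltcE /= => /andP[].
  by rewrite RRe_real // gtr0_real.
by rewrite ed; apply: filterS (H d d0) => t; rewrite normE ltcR.
Qed.

Lemma Re_continuous : continuous (Re : C -> R).
Proof.
move=> z; apply/(@cvgrPdist_lt _ R^o _ (nbhs z)) => e e0.
near=> w; have : cmod (z - w) < e by near: w; exact: near_cmod.
apply: le_lt_trans.
by rewrite -ReB Re_le_cmod.
Unshelve. all: by end_near. Qed.

Lemma Im_continuous : continuous (Im : C -> R).
Proof.
move=> z; apply/(@cvgrPdist_lt _ R^o _ (nbhs z)) => e e0.
near=> w; have : cmod (z - w) < e by near: w; exact: near_cmod.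
apply: le_lt_trans.
by rewrite -ImB Im_le_cmod.
Unshelve. all: by end_near. Qed.

Lemma cvg_cplx (T : Type) (F : set_system T) (FF : Filter F) (u v : T -> R) x y :
  u @ F --> x -> v @ F --> y -> (fun t => cplx (u t) (v t)) @ F --> cplx x y.
Proof.
move=> ux vy; apply: cvg_cmodP => e e0.
have e20 : 0 < e / 2 by rewrite divr_gt0.
move/(@cvgrPdist_lt _ R^o _ F) : ux => /(_ _ e20) ux.
move/(@cvgrPdist_lt _ R^o _ F) : vy => /(_ _ e20) vy.
near=> t; apply: le_lt_trans (cmod_le _) _; rewrite (splitr e) ltrD //=.
  by near: t.
by near: t.
Unshelve. all: by end_near. Qed.

Section ContinuousArithmetic.
Variables (T : topologicalType) (f g : T -> C) (t : T).
Hypotheses (cf : {for t, continuous f}) (cg : {for t, continuous g}).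

Lemma continuous_addC : {for t, continuous (fun s => f s + g s)}.
Proof. exact: (@cvgD _ C^o T (nbhs t) _ _ _ _ _ cf cg). Qed.

Lemma continuous_mulC : {for t, continuous (fun s => f s * g s)}.
Proof. exact: (@cvgM C T (nbhs t) _ _ _ _ _ cf cg). Qed.

Lemma continuous_invC : f t != 0 -> {for t, continuous (fun s => (f s)^-1)}.
Proof. by move=> f0; exact: (@cvgV C T (nbhs t) _ f (f t) f0 cf). Qed.

End ContinuousArithmetic.

Lemma cmod_continuous : continuous (cmod : C -> R).
Proof.
move=> z; apply: (@continuous_comp C R R _ Num.sqrt);
  last exact: sqrt_continuous.
by apply: (@cvgD _ R^o C (nbhs z)); apply: (@cvgM R C (nbhs z));
  (exact: Re_continuous || exact: Im_continuous).
Qed.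

Definition cexp z : C :=
  cplx (expR (Re z) * cos (Im z)) (expR (Re z) * sin (Im z)).

Lemma cexp0 : cexp 0 = 1.
Proof. by rewrite /cexp /= expR0 cos0 sin0 mulr1 mulr0. Qed.

Lemma cexpD z w : cexp (z + w) = cexp z * cexp w.
Proof.
case: z w => [a b] [c d]; rewrite /cexp /= expRD cosD sinD.
by rewrite /cplx; simpc; congr (_ +i* _)%C; ring.
Qed.

Lemma cmod_cexp z : cmod (cexp z) = expR (Re z).
Proof.
rewrite /cmod /cexp /= !exprMn -mulrDr cos2Dsin2 mulr1 sqrtr_sqr.
by rewrite ger0_norm ?expR_ge0.
Qed.

Lemma cexp_neq0 z : cexp z != 0.
Proof. by rewrite -cmod_gt0 cmod_cexp expR_gt0. Qed.

Lemma cexpN z : cexp (- z) = (cexp z)^-1.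
Proof.
by apply: (mulfI (cexp_neq0 z)); rewrite -cexpD subrr cexp0 divff ?cexp_neq0.
Qed.

Lemma cexp_continuous : continuous cexp.
Proof.
move=> z; have cRe : expR (Re w) @[w --> z] --> expR (Re z).
  by apply: (@continuous_comp C R R);
    [exact: Re_continuous|exact: continuous_expR].
apply: (@cvg_cplx C (nbhs z)); apply: (@cvgM R C (nbhs z) _ _ _ _ _ cRe).
- by apply: (@continuous_comp C R R);
    [exact: Im_continuous|exact: continuous_cos].
- by apply: (@continuous_comp C R R);
    [exact: Im_continuous|exact: continuous_sin].
Qed.

Definition period : C := cplx 0 (pi *+ 2).

Lemma period_neq0 : period != 0.
Proof. by rewrite eq_complex /= negb_and orbC mulrn_eq0 /= gt_eqF ?pi_gt0. Qed.

Lemma cexp_period (k : int) : cexp (period *~ k) = 1.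
Proof.
have p1 : cexp period = 1 by rewrite /cexp /= expR0 cos2pi sin2pi mulr1 mulr0.
have pn n : cexp (period *+ n) = 1.
  by elim: n => [|n IH]; rewrite ?mulr0n ?cexp0 // mulrS cexpD p1 IH mul1r.
by case: k => n; rewrite ?NegzE ?mulrNz ?cexpN pn ?invr1.
Qed.

Lemma real_modE p y : 0 < p ->
  exists (k : int) r, [/\ y = r + p *~ k, 0 <= r & r < p].
Proof.
move=> p0; set k := Num.floor (y / p).
have /andP[kl ku] := floor_itv (y / p).
exists k, (y - p *~ k); split; first by rewrite subrK.
  by rewrite subr_ge0 -mulrzr mulrC -ler_pdivlMr.
move: ku; rewrite ltr_pdivrMr // intrD mulrDl mul1r => ku.
by rewrite ltrBlDr -mulrzr mulrC addrC.
Qed.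

Lemma periodz (k : int) : period *~ k = cplx 0 (pi *+ 2 *~ k).
Proof.
have pn n : period *+ n = cplx 0 (pi *+ 2 *+ n).
  by elim: n => [|n IH] //; rewrite !mulrS IH /cplx; simpc.
by case: k => n; rewrite ?NegzE ?mulrNz -!pmulrn pn //= /cplx; simpc.
Qed.

Lemma cexp_eq1 z : cexp z = 1 -> exists k : int, z = period *~ k.
Proof.
move=> z1; have pi2 : 0 < pi *+ 2 :> R by rewrite mulrn_wgt0 // pi_gt0.
have rez : Re z = 0 by apply: expR_inj; rewrite expR0 -cmod_cexp z1 cmod1.
have [k [r [zr r0 r2]]] := real_modE (Im z) pi2; exists k.
have {}zr : z = cplx 0 r + period *~ k.
  by rewrite [LHS]cplxE rez zr periodz /cplx; simpc.
move: z1; rewrite zr cexpD cexp_period mulr1 => -[];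
  rewrite /= expR0 !mul1r => cr _.
have [r_eq0|r_neq0] := eqVneq r 0; first by rewrite r_eq0 add0r.
have r_gt0 : 0 < r by rewrite lt_def r_neq0.
(* If 0 < r < 2 pi, then 1 - cos r = 2 sin(r/2)^2 is positive, which contradicts cos r = 1. *)
have : 0 < sin (r / 2).
  by rewrite sin_gt0_pi // divr_gt0 //= ltr_pdivrMr // mulr_natr.
have : cos ((r / 2) *+ 2) = 1 by rewrite -mulr_natr divfK // pnatr_eq0.
rewrite cos_mulr2n cos2sin2 => ? ?; exfalso; nra.
Qed.

(** The arctangent of the slope is the argument only for [0 < Re z]; this half of the principal
    branch is all that the lifting uses. *)
Definition clog z : C := cplx (ln (cmod z)) (atan (Im z / Re z)).

Lemma clogK z : 0 < Re z -> cexp (clog z) = z.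
Proof.
move=> rz; have cz : 0 < cmod z by apply: lt_le_trans (Re_le_cmod z);
  rewrite normr_gt0 gt_eqF.
rewrite /cexp /clog /= lnK ?posrE //.
have ct : cmod z * cos (atan (Im z / Re z)) = Re z.
  rewrite cos_atan /cmod.
  have -> : Re z ^+ 2 + Im z ^+ 2 = (Re z) ^+ 2 * (1 + (Im z / Re z) ^+ 2).
    by field; rewrite gt_eqF.
  rewrite sqrtrM ?sqr_ge0 // sqrtr_sqr gtr0_norm // mulfK //.
  by rewrite gt_eqF // sqrtr_gt0 ltr_pwDl // sqr_ge0.
have ca : cos (atan (Im z / Re z)) != 0.
  by apply: contra_eq_neq ct => ->; rewrite mulr0 eq_sym gt_eqF.
rewrite ct [RHS]cplxE; congr cplx.
have := atanK (Im z / Re z); set a := atan _ in ct ca * => ta.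
have -> : Im z = tan a * Re z by rewrite ta divfK ?gt_eqF.
by rewrite /tan -ct mulrCA mulrC divfK // mulrC.
Qed.

Lemma clog_continuous z : 0 < Re z -> {for z, continuous clog}.
Proof.
move=> rz; have cz : 0 < cmod z by apply: lt_le_trans (Re_le_cmod z);
  rewrite normr_gt0 gt_eqF.
apply: (@cvg_cplx C (nbhs z)).
  by apply: (@continuous_comp C R R);
    [exact: cmod_continuous|exact: continuous_ln].
apply: (@continuous_comp C R R); last exact: continuous_atan.
apply: (@cvgM R C (nbhs z)); first exact: Im_continuous.
by apply: (@cvgV R C (nbhs z)); [rewrite gt_eqF|exact: Re_continuous].
Qed.

Lemma clog1 : clog 1 = 0.
Proof. by rewrite /clog cmod1 ln1 /= mul0r atan0. Qed.

Lemma cexp_surj z : z != 0 -> exists w, cexp w = z.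
Proof.
have pos (u : C) : 0 < Re u -> exists w, cexp w = u.
  by move=> ru; exists (clog u); rewrite clogK.
pose J : C := cplx 0 (pi / 2).
have eJ : cexp J = cplx 0 1 by rewrite /cexp /= expR0 cos_pihalf sin_pihalf mulr0 mulr1.
(* Multiplication by -i is a quarter turn, which [J] undoes on the side of the logarithm. At most
   three such turns bring a nonzero number into the right half-plane. *)
have rot u : (exists w, cexp w = u * cplx 0 (-1)) -> exists w, cexp w = u.
  case=> w we; exists (J + w); rewrite cexpD we eJ mulrCA.
  by rewrite [X in u * X](_ : _ = 1) ?mulr1 //; apply/eqP;
    rewrite eq_complex /=; apply/andP; split; apply/eqP; ring.
move=> z0; have [rz|rz|rz] := ltgtP (Re z) 0; last 1 first.
- have [iz|iz|iz] := ltgtP (Im z) 0.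
  + do 3 apply: (rot _); apply: pos; case: z iz {rz z0} => a b /= ?.
    by rewrite /cplx; simpc => /=; lra.
  + apply: (rot _); apply: pos; case: z iz {rz z0} => a b /= ?.
    by rewrite /cplx; simpc => /=; lra.
  + by move: z0; rewrite [z]cplxE rz iz eqxx.
- do 2 apply: (rot _); apply: pos; case: z rz {z0} => a b /= ?.
  by rewrite /cplx; simpc => /=; lra.
- exact: pos.
Qed.

End ComplexPlane.

(** * Lifting through the exponential *)

Section Lifting.
Variable R : realType.
Local Notation C := (Cx R).
Local Notation Re := (@complex.Re R).
Local Notation Im := (@complex.Im R).
Local Notation period := (period R).
Implicit Types (z w : C) (x y : R).

(** Squares serve instead of discs because they are images of products of segments, which makes them
    compact; they are star-shaped around 0 as well. *)
Definition box (r : R) : set C := [set z | `|Re z| <= r /\ `|Im z| <= r].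

Lemma box_compact r : compact (box r).
Proof.
have -> : box r = (fun p : R * R => cplx p.1 p.2) @` (`[- r, r] `*` `[- r, r]).
  apply/seteqP; split=> [z [rz iz]|_ [[x y] /= [xr yr] <-]].
    by exists (Re z, Im z); rewrite /= -?cplxE //= !in_itv /= -!ler_norml.
  by rewrite /box /= !ler_norml; move: xr yr; rewrite !in_itv.
apply: (@continuous_compact (R * R)%type C); last first.
  by apply: compact_setX; exact: segment_compact.
apply: continuous_subspaceT => p.
by apply: (@cvg_cplx R (R * R)%type (nbhs p)); [exact: cvg_fst|exact: cvg_snd].
Qed.

Lemma boxZ r x z : 0 <= x <= 1 -> box r z -> box r (x%:C%C * z).
Proof.
move=> /andP[x0 x1]; case: z => [a b] [/= ar br]; split => /=.
  rewrite mul0r subr0 normrM ger0_norm //; apply: le_trans ar.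
  by rewrite ler_piMl.
rewrite mul0r addr0 normrM ger0_norm //; apply: le_trans br.
by rewrite ler_piMl.
Qed.

Lemma box_le r s z : r <= s -> box r z -> box s z.
Proof. by move=> rs [rz iz]; split; exact: le_trans rs. Qed.

Lemma cmod_box r z : cmod z <= r -> box r z.
Proof.
by move=> zr; split; apply: le_trans zr; [exact: Re_le_cmod|exact: Im_le_cmod].
Qed.

Lemma continuous_sum (n : nat) (f : nat -> C -> C) z :
  (forall k, (k < n)%N -> {for z, continuous (f k)}) ->
  {for z, continuous (fun w => \sum_(k < n) f k w)}.
Proof.
elim: n => [|n IH] fc; rewrite /prop_for /=.
  under eq_fun do rewrite big_ord0.
  exact: cst_continuous.
under eq_fun do rewrite big_ord_recr.
apply: continuous_addC; last exact: fc.
by apply: IH => k kn; apply: fc; rewrite ltnS ltnW.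
Qed.

(** The ratio is continuous on pairs and equals 1 at [(z0, z0)], and the open disc of radius 1
    around 1 lies in the right half-plane. *)
Lemma Re_ratio_gt0 (F : C -> C) z0 : {for z0, continuous F} -> F z0 != 0 ->
  exists2 e, 0 < e & forall z w, cmod (z0 - z) < e -> cmod (z0 - w) < e ->
    0 < Re (F w / F z).
Proof.
move=> cF F0.
pose G (p : C * C) := F p.2 / F p.1.
have cG : {for (z0, z0), continuous G}.
  apply: continuous_mulC.
    by apply: (@continuous_comp (C * C)%type C C snd F);
      [exact: cvg_snd|exact: cF].
  apply: continuous_invC => //.
  by apply: (@continuous_comp (C * C)%type C C fst F);
    [exact: cvg_fst|exact: cF].
have G1 : G (z0, z0) = 1 by rewrite /G divff.
have nG : nbhs (G (z0, z0)) [set u | cmod (1 - u) < 1].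
  by rewrite G1; exact: near_cmod.
have [[A B] [/= nA nB] AB] := cG _ nG.
have [d /= d0 dAB] : nbhs z0 (A `&` B) by exact: filterI.
have [dr d0'] : d = (Re d)%:C%C /\ 0 < Re d.
  by move: d0; case: d {dAB} => a b; rewrite ltcE /= => /andP[/eqP -> ->].
exists (Re d) => // z w zd wd.
have [Az _] : (A `&` B) z by apply: dAB; rewrite /ball_ /= normE dr ltcR.
have [_ Bw] : (A `&` B) w by apply: dAB; rewrite /ball_ /= normE dr ltcR.
have /= := AB (z, w) (conj Az Bw).
rewrite /G /= => /(le_lt_trans (Re_le_cmod _)).
rewrite ReB ltr_norml => /andP[_]; rewrite ltrBlDr ltrDl.
by [].
Qed.

Lemma box_uniform (F : C -> C) r : continuous F -> (forall z, F z != 0) ->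
  exists2 d, 0 < d & forall z w, box r z -> cmod (z - w) < d ->
    0 < Re (F w / F z).
Proof.
move=> cF F0.
have /compact_near_coveringP := @box_compact r.
move=> /(_ _ (0^'+) (fun d z => forall w, cmod (z - w) < d -> 0 < Re (F w / F z))).
case/(_ _ _) => [z0 _|d /= d0 dP].
  have [e e0 eP] := Re_ratio_gt0 (cF z0) (F0 z0).
  have e20 : 0 < e / 2 by rewrite divr_gt0.
  (* Halving [e] keeps both [z] and any [w] within [d] of it inside the disc of radius [e] around
     [z0]. *)
  exists ([set z | cmod (z0 - z) < e / 2], [set d | d < e / 2]) => /=.
    by split; [exact: near_cmod|exact: nbhs_right_lt].
  move=> [z d] /= [zz0 de] w zw; apply: eP; first by apply: lt_trans zz0 _; lra.
  have -> : z0 - w = (z0 - z) + (z - w) by ring.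
  rewrite -ltcR -normE; apply: le_lt_trans (ler_normD _ _) _.
  by rewrite !normE -rmorphD ltcR; lra.
have d20 : 0 < d / 2 by rewrite divr_gt0.
exists (d / 2) => // z w zb zw.
apply: (dP (d / 2)) zw => //.
rewrite /ball_ /= sub0r normrN gtr0_norm //; lra.
Qed.

(* [L z] adds up the logarithms of the ratios of consecutive values of [F] along
   a subdivision of the segment from 0 to z, uniform in z. *)
Lemma box_lift (F : C -> C) l0 r : continuous F -> (forall z, F z != 0) ->
  cexp l0 = F 0 ->
  exists L : C -> C, [/\ L 0 = l0, forall z, box r z -> {for z, continuous L}
    & forall z, box r z -> cexp (L z) = F z].
Proof.
move=> cF F0 Fl; have [d d0 dP] := @box_uniform F r cF F0.
(* Points of the box have modulus at most 2|r|, so each of the [n] pieces of the segment is shorter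
   than [d]. *)
pose n := (Num.trunc (2 * `|r| / d)).+1.
have nd : 2 * `|r| < n%:R * d by rewrite -ltr_pdivrMr //; exact: truncnS_gt.
have n0 : 0 < n%:R :> R by rewrite ltr0n.
pose p (k : nat) z : C := (k%:R / n%:R)%:C%C * z.
pose s (k : nat) z := clog (F (p k.+1 z) / F (p k z)).
have pbox k z : (k <= n)%N -> box r z -> box r (p k z).
  move=> kn; apply: boxZ; rewrite divr_ge0 //= ler_pdivrMr // mul1r ler_nat //.
have pd k z : box r z -> cmod (p k z - p k.+1 z) < d.
  move=> [zr1 zr2].
  have -> : p k z - p k.+1 z = (- n%:R^-1)%:C%C * z.
    by rewrite /p -mulrBl -rmorphB; congr (_%:C%C * _); field; rewrite gt_eqF.
  apply: le_lt_trans (_ : n%:R^-1 * (2 * `|r|) < d);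
    last by rewrite ltr_pdivrMl.
  have -> : cmod ((- n%:R^-1)%:C%C * z) = n%:R^-1 * cmod z.
    by rewrite cmodM /cmod /= expr0n addr0 sqrtr_sqr normrN gtr0_norm ?invr_gt0.
  rewrite ler_wpM2l ?invr_ge0 ?(ltW n0) //; apply: le_trans (cmod_le z) _.
  by have := ler_norm r; lra.
have rat k z : (k < n)%N -> box r z -> 0 < Re (F (p k.+1 z) / F (p k z)).
  move=> kn zb; apply: dP; last exact: pd.
  by apply: pbox => //; exact: ltnW.
have cp k z : {for z, continuous (p k)}.
  by apply: continuous_mulC; [exact: cst_continuous|exact: cvg_id].
have cFp k z : {for z, continuous (fun z => F (p k z))}.
  by apply: (@continuous_comp C C C); [exact: cp|exact: cF].
exists (fun z => l0 + \sum_(k < n) s k z); split.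
- rewrite big1 ?addr0 // => k _; rewrite /s /p !mulr0 divff ?F0 //.
  exact: clog1.
- move=> z zb; apply: continuous_addC; first exact: cst_continuous.
  apply: continuous_sum => k kn.
  apply: (@continuous_comp C C C); last by apply: clog_continuous; exact: rat.
  apply: continuous_mulC; first exact: cFp.
  by apply: continuous_invC; [exact: cFp|exact: F0].
- move=> z zb.
  have H m : (m <= n)%N -> cexp (l0 + \sum_(k < m) s k z) = F (p m z).
    elim: m => [|m IH] mn.
      by rewrite big_ord0 addr0 Fl /p mul0r mul0r.
    rewrite big_ord_recr addrA cexpD IH ?(ltnW mn) // clogK ?rat //.
    by rewrite mulrC divfK ?F0.
  by rewrite H // /p divff ?gt_eqF // mul1r.
Qed.

(** The values of [D] are integer multiples of [period]. If the two end values differed, the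
    intermediate value theorem would give the imaginary part of [D] an odd multiple of pi as a
    value. *)
Lemma cexp1_segment (D : R -> C) :
  (forall s, 0 <= s <= 1 -> {for s, continuous D}) ->
  (forall s, 0 <= s <= 1 -> cexp (D s) = 1) -> D 0 = D 1.
Proof.
move=> cD D1; have pi2 : 0 < pi *+ 2 :> R by rewrite mulrn_wgt0 // pi_gt0.
have Dk s : 0 <= s <= 1 -> exists k : int, D s = period *~ k.
  by move=> s01; apply: cexp_eq1; exact: D1.
have [k Dk0] : exists k : int, D 0 = period *~ k by apply: Dk;
  rewrite lexx ler01.
have [m Dm1] : exists m : int, D 1 = period *~ m by apply: Dk;
  rewrite lexx ler01.
have imk j : Im (period *~ j) = (pi *+ 2) * j%:~R :> R by rewrite periodz /= mulrzr.
have [-> //|km] := eqVneq (D 0) (D 1).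
have {}km : k != m by apply: contra_neq km => km; rewrite Dk0 Dm1 km.
(* [v] lies strictly between consecutive multiples of 2 pi. *)
pose v : R := (pi *+ 2) * ((Num.min k m)%:~R + 1 / 2).
have cI : {within `[0, 1], continuous (Im \o D)}.
  apply: continuous_in_subspaceT => s; rewrite inE /= in_itv /= => s01.
  apply: (@continuous_comp R C R); [exact: cD|exact: Im_continuous].
have [|c] := @IVT R (Im \o D) 0 1 v ler01 cI.
  rewrite /= Dk0 Dm1 !imk /v ge_min le_max !ler_pM2l //.
  have [lkm|lmk|ekm] := ltgtP k m; last by rewrite ekm eqxx in km.
    have : (k + 1)%:~R <= m%:~R :> R by rewrite ler_int lezD1.
    by rewrite intrD => ?; apply/andP; split; apply/orP; [left|right]; lra.
  have : (m + 1)%:~R <= k%:~R :> R by rewrite ler_int lezD1.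
  by rewrite intrD => ?; apply/andP; split; apply/orP; [right|left]; lra.
rewrite in_itv /= => /Dk[j ->]; rewrite imk /v => /(mulfI (lt0r_neq0 pi2)) jE.
have : (2 * j)%:~R = (2 * Num.min k m + 1)%:~R :> R by rewrite intrD !intrM jE;
  field.
by move/intr_inj; lia.
Qed.

(** Along the segment from 0 to [z], which stays in the box, the difference of the two lifts is a
    continuous logarithm of 1, so its end values agree. *)
Lemma lift_unique (L1 L2 : C -> C) r : L1 0 = L2 0 ->
  (forall z, box r z -> {for z, continuous L1}) ->
  (forall z, box r z -> {for z, continuous L2}) ->
  (forall z, box r z -> cexp (L1 z) = cexp (L2 z)) ->
  forall z, box r z -> L1 z = L2 z.
Proof.
move=> L0 c1 c2 E z zb.
pose D (s : R) : C := L1 (s%:C%C * z) + - 1 * L2 (s%:C%C * z).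
have cz (s : R) : {for s, continuous (fun u : R => u%:C%C * z : C)}.
  apply: continuous_mulC; last exact: cst_continuous.
  by apply: (@cvg_cplx R R (nbhs s)); [exact: cvg_id|exact: cvg_cst].
have : D 0 = D 1.
  apply: cexp1_segment => s s01.
    apply: continuous_addC.
      by apply: (@continuous_comp R C C); [exact: cz|apply: c1; exact: boxZ].
    apply: continuous_mulC; first exact: cst_continuous.
    by apply: (@continuous_comp R C C); [exact: cz|apply: c2; exact: boxZ].
  by rewrite /D mulN1r cexpD cexpN E ?divff ?cexp_neq0 //; exact: boxZ.
rewrite /D !mul0r L0 !mulN1r subrr !mul1r => /esym/eqP; rewrite subr_eq0.
by move/eqP.
Qed.

(** Lifts on growing boxes with a common value at 0 agree by uniqueness and can be glued; no bound
    on [F] that is uniform over the plane is required. *)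
Lemma cexp_lift (F : C -> C) : continuous F -> (forall z, F z != 0) ->
  exists2 L : C -> C, continuous L & forall z, cexp (L z) = F z.
Proof.
move=> cF F0; have [l0 Fl] := cexp_surj (F0 0).
have /choice [L LP] : forall n : nat, exists L : C -> C,
    [/\ L 0 = l0, forall z, box n%:R z -> {for z, continuous L}
      & forall z, box n%:R z -> cexp (L z) = F z].
  by move=> n; exact: box_lift.
pose N z := (Num.trunc (cmod z)).+1.
have Nb z : box (N z)%:R z by apply: cmod_box; rewrite ltW // truncnS_gt.
have Lm m n z : (m <= n)%N -> box m%:R z -> L m z = L n z.
  move=> mn; have bmn w : box m%:R w -> box n%:R w.
    by apply: box_le; rewrite ler_nat.
  have [m0 mc mE] := LP m; have [n0 nc nE] := LP n.
  apply: lift_unique; [by rewrite m0 n0|exact: mc|..] => w wb.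
    by apply: nc; exact: bmn.
  by rewrite mE ?nE //; exact: bmn.
exists (fun z => L (N z) z); last by move=> z; have [_ _ ->] := LP (N z).
move=> z0; have [_ c1 _] := LP (N z0).+1.
have b1 : box (N z0).+1%:R z0 by apply: box_le (Nb z0); rewrite ler_nat.
rewrite /continuous_at (Lm (N z0) (N z0).+1 z0) //.
apply: (@cvg_trans _ (L (N z0).+1 @ nbhs z0)); last exact: (c1 z0 b1).
(* The index [N z] may jump near [z0], but on the unit disc around [z0] the glued map coincides with
   the single lift of index [(N z0).+1], whose box contains that disc. *)
apply: (@near_eq_cvg C C (nbhs z0)); near=> z.
have zz0 : cmod (z0 - z) < 1 by near: z; exact: near_cmod.
have zb : cmod z <= (N z0).+1%:R.
  have := ler_normB z0 (z0 - z); rewrite subKr !normE -rmorphD lecR.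
  move/le_trans; apply; rewrite mulrS addrC.
  by apply: lerD; apply: ltW => //; exact: truncnS_gt.
have [nz|/ltnW nz] := leqP (N z) (N z0).+1; first by rewrite (Lm _ _ _ nz).
by rewrite -(Lm _ _ _ nz) //; exact: cmod_box.
Unshelve. all: by end_near. Qed.

End Lifting.

(** * Conjugate rotations *)

Section Rotation.
Variable R : realType.
Local Notation C := (Cx R).
Local Notation Re := (@complex.Re R).
Local Notation Im := (@complex.Im R).
Local Notation period := (period R).
Implicit Types (z w : C) (x y : R).

Lemma cexp1_const (D : C -> C) : continuous D -> (forall z, cexp (D z) = 1) ->
  exists k : int, forall z, D z = period *~ k.
Proof.
move=> cD D1; have [k D0] := cexp_eq1 (D1 0); exists k => z.
rewrite -D0; apply: (@lift_unique R D (fun=> D 0) (cmod z)); first by [].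
- by move=> w _; exact: cD.
- by move=> w _; exact: cst_continuous.
- by move=> w _; rewrite !D1.
- exact: cmod_box.
Qed.

Lemma quasi_periodz (H : C -> C) p c : (forall z, H (z + p) = H z + c) ->
  forall (k : int) z, H (z + p *~ k) = H z + c *~ k.
Proof.
move=> Hp; have Hn n z : H (z + p *+ n) = H z + c *+ n.
  by elim: n => [|n IH]; rewrite ?addr0 // !mulrSr !addrA Hp IH.
case=> n z; first exact: Hn.
rewrite !NegzE !mulrNz; apply: (addIr (c *+ n.+1)).
by rewrite -Hn !subrK.
Qed.

(** After subtracting d z the function has period 2 pi i, so its maximum modulus over one period
    bounds it on the imaginary axis. Translations by [a] preserve the axis and add c - d a each
    time; [n] of them would break the bound unless this increment vanishes. *)
Lemma quasi_period_slope (H : C -> C) (d : int) a c : continuous H ->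
  (forall z, H (z + period) = H z + period *~ d) ->
  Re a = 0 -> (forall z, H (z + a) = H z + c) -> c = a *~ d.
Proof.
move=> cH Hp ra Ha; have pi2 : 0 < pi *+ 2 :> R by rewrite mulrn_wgt0 // pi_gt0.
pose G z := H z + - d%:~R * z.
(* The summand 0 gives the equation the shape that [quasi_periodz] expects. *)
have Gp z : G (z + period) = G z + 0.
  rewrite /G Hp -mulrzl; ring.
have Ga z : G (z + a) = G z + (c - a *~ d).
  rewrite /G Ha -[a *~ d]mulrzl; ring.
have cG : continuous G.
  move=> z; apply: continuous_addC; first exact: cH.
  by apply: continuous_mulC; [exact: cst_continuous|exact: cvg_id].
have cGi : continuous (fun y => cmod (G (cplx 0 y))).
  move=> y; apply: (@continuous_comp R C R); last exact: cmod_continuous.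
  apply: (@continuous_comp R C C); last exact: cG.
  by apply: (@cvg_cplx R R (nbhs y)); [exact: cvg_cst|exact: cvg_id].
have [y0 _ y0max] := EVT_max (ltW pi2) (continuous_subspaceT cGi).
set B := cmod (G (cplx 0 y0)) in y0max.
have GB y : cmod (G (cplx 0 y)) <= B.
  have [k [r [-> r0 r2]]] := real_modE y pi2.
  have -> : cplx 0 (r + pi *+ 2 *~ k) = cplx 0 r + period *~ k.
    by rewrite periodz /cplx; simpc.
  rewrite (quasi_periodz Gp) mul0rz addr0; apply: y0max.
  by rewrite in_itv /= r0 ltW.
apply/eqP; rewrite -subr_eq0 -cmod_eq0; apply/negPn/negP => e0.
set e := c - a *~ d in Ga e0.
have {}e0 : 0 < cmod e by rewrite lt_def e0 cmod_ge0.
(* Two values of [G] on the axis differ by at most 2B, but [n] translations by [a] shift it by more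
   than that. *)
pose n := (Num.trunc (2 * B / cmod e)).+1.
have : 2 * B < n%:R * cmod e by rewrite -ltr_pdivrMr //; exact: truncnS_gt.
have an : 0 + a *~ n = cplx 0 (Im a *+ n).
  rewrite add0r -pmulrn; elim: (n) => [|m IH] //.
  by rewrite !mulrS IH [a in LHS]cplxE ra /cplx; simpc.
have := quasi_periodz Ga n 0; rewrite an; set g := G _ => Gn.
have := ler_normB g (G 0).
have -> : g - G 0 = n%:R * e by rewrite Gn addrAC subrr add0r -pmulrn mulr_natl.
rewrite normrM normr_nat !normE -(rmorph_nat (real_complex R)) -rmorphM -rmorphD lecR.
have gB : cmod g <= B by exact: GB.
have G0B : cmod (G 0) <= B by exact: (GB 0).
by move=> + /lt_le_trans => /[swap] /[apply]; lra.
Qed.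

Theorem conjugate_rotations (h h' : C -> C) (mu nu : C) :
  (forall z, z != 0 -> {for z, continuous h}) ->
  (forall z, z != 0 -> {for z, continuous h'}) ->
  (forall z, z != 0 -> h z != 0) -> (forall z, z != 0 -> h' z != 0) ->
  (forall z, z != 0 -> h' (h z) = z) ->
  (forall z, z != 0 -> h (nu * z) = mu * h z) ->
  cmod nu = 1 -> mu != 0 -> mu = nu \/ mu = nu^-1.
Proof.
move=> ch ch' h0 h'0 hK hnu nu1 mu0.
have lifts (f : C -> C) : (forall z, z != 0 -> {for z, continuous f}) ->
    (forall z, z != 0 -> f z != 0) ->
    exists2 L : C -> C, continuous L & forall z, cexp (L z) = f (cexp z).
  move=> cf f0; have cfe : continuous (fun z => f (cexp z)).
    move=> z; apply: (@continuous_comp C C C); first exact: cexp_continuous.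
    by apply: cf; exact: cexp_neq0.
  have fe0 z : f (cexp z) != 0 by apply: f0; exact: cexp_neq0.
  by have [L cL LE] := cexp_lift cfe fe0; exists L.
have [H cH HE] := lifts h ch h0; have [H' cH' H'E] := lifts h' ch' h'0.
(* Both sides have the same exponential, so they differ by a constant multiple of [period]. This
   serves for the period itself ([b] is 0) and for the rotation ([b] is a logarithm of [mu]). *)
have shift (L : C -> C) a b : continuous L ->
    (forall z, cexp (L (z + a)) = cexp (L z) * cexp b) ->
    exists k : int, forall z, L (z + a) = L z + (b + period *~ k).
  move=> cL Lab;
    have [|z|k Dk] := @cexp1_const (fun z => L (z + a) + (- 1 * L z + - b)).
  - move=> z;
      apply: (@continuous_addC R C (fun s => L (s + a)) (fun s => - 1 * L s + - b)).
      apply: (@continuous_comp C C C (fun s => s + a) L); last exact: cL.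
      by apply: continuous_addC; [exact: cvg_id|exact: cst_continuous].
    apply: (@continuous_addC R C (fun s => - 1 * L s));
      last exact: cst_continuous.
    by apply: continuous_mulC; [exact: cst_continuous|exact: cL].
  - rewrite mulN1r cexpD Lab cexpD !cexpN -invfM divff //.
    by rewrite mulf_neq0 ?cexp_neq0.
  - by exists k => z; rewrite -(Dk z); ring.
have p1 : cexp period = 1 by have := cexp_period R 1.
have periodic (L f : C -> C) : continuous L -> (forall z, cexp (L z) = f (cexp z)) ->
    exists k : int, forall z, L (z + period) = L z + period *~ k.
  move=> cL LE; have [|k Lk] := shift L period 0 cL.
    by move=> z; rewrite cexp0 mulr1 !LE cexpD p1 mulr1.
  by exists k => z; rewrite Lk add0r.
have [d Hd] := periodic H h cH HE; have [d' H'd] := periodic H' h' cH' H'E.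
(* The composite of the two lifts lifts the identity, so it is a translation by a multiple of
   [period]. Evaluating it at 0 and at [period] shows that the degrees multiply to 1. *)
have [|z|k HK] := @cexp1_const (fun z => H' (H z) + - 1 * z).
- move=> z; apply: continuous_addC.
    by apply: (@continuous_comp C C C H H'); [exact: cH|exact: cH'].
  by apply: continuous_mulC; [exact: cst_continuous|exact: cvg_id].
- by rewrite mulN1r cexpD H'E HE hK ?cexp_neq0 // cexpN divff ?cexp_neq0.
have dd : d' * d = 1.
  have := HK (0 + period);
    rewrite -(HK 0) Hd (quasi_periodz H'd) mulr0 addr0 add0r.
  move=> e; have {e} : period *~ (d' * d) = period.
    rewrite mulrzA; apply: (addrI (H' (H 0))); apply: (addIr (- 1 * period)).
    by rewrite e mulN1r addrK.
  move/(congr1 (fun u => u - period));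
    rewrite subrr -{2}[period]mulr1z -mulrzBr.
  by move/eqP; rewrite mulrz_eq0 (negPf (period_neq0 R)) orbF subr_eq0 => /eqP.
have nu0 : nu != 0 by rewrite -cmod_eq0 nu1 oner_eq0.
have [a aE] := cexp_surj nu0; have [b bE] := cexp_surj mu0.
have ra : Re a = 0 by apply: expR_inj; rewrite expR0 -cmod_cexp aE nu1.
have [|m Hm] := shift H a b cH.
  by move=> z; rewrite !HE cexpD aE bE mulrC hnu ?cexp_neq0 // mulrC.
(* The translation constant of [H] is again a logarithm of [mu], and the slope lemma identifies it
   as d a. *)
have bE' : cexp (b + period *~ m) = mu by rewrite cexpD cexp_period mulr1.
have := quasi_period_slope cH Hd ra Hm => ba; rewrite -bE' ba.
have /eqP : (`|d'| * `|d|)%N = 1%N by rewrite -abszM dd.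
rewrite muln_eq1 => /andP[_ /eqP d1].
have [->|->] : d = 1 \/ d = -1 by lia.
  by left; rewrite mulr1z.
by right; rewrite mulrN1z cexpN aE.
Qed.

End Rotation.

(** * Continuity on the sphere *)

Section Sphere.
Variable R : realType.
Local Notation C := (Cx R).
Local Notation Re := (@complex.Re R).
Local Notation Im := (@complex.Im R).
Local Notation S2 := (sphere C).
Implicit Types (z w : C) (x y : R).

(** A nonempty compact set is bounded because the modulus attains its maximum on it; conversely
    every disc lies in a compact box. *)
Lemma nbhs_infty (U : set S2) :
  nbhs (None : S2) U <-> U None /\ exists r, forall z, r < cmod z -> U (Some z).
Proof.
split=> [[W [cW _] WU]|[UN [r Ur]]].
  split; first by apply: WU; right.
  have [W0|/set0P W0] := eqVneq W set0.
    by exists 0 => z _; apply: WU; left; exists z => //; rewrite W0.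
  have cc : {within W, continuous (@cmod R : C -> R)}.
    by apply: continuous_subspaceT; exact: cmod_continuous.
  have [c _ cmax] := compact_EVT_max W0 cW cc.
  exists (cmod c) => z cz; apply: WU; left; exists z => // Wz.
  by have := cmax z; rewrite inE => /(_ Wz); rewrite leNgt cz.
have bc := @box_compact R r.
exists (box r).
  split=> //; apply: compact_closed bc.
  exact: (@norm_hausdorff _ C^o).
move=> _ [[z /= zb <-]|->] //; apply: Ur; rewrite ltNge; apply/negP => zr.
by apply: zb; exact: cmod_box.
Qed.

Lemma nbhs_someP z (U : set S2) :
  nbhs (Some z : S2) U <-> \forall w \near nbhs z, U (Some w).
Proof. by []. Qed.

Lemma near_norm z (U : set C) : nbhs z U ->
  exists2 e, 0 < e & forall w, cmod (z - w) < e -> U w.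
Proof.
move=> [d /= d0 dU]; have [dr d0'] : d = (Re d)%:C%C /\ 0 < Re d.
  by move: d0; case: d {dU} => a b; rewrite ltcE /= => /andP[/eqP -> ->].
by exists (Re d) => // w wd; apply: dU; rewrite /ball_ /= normE dr ltcR.
Qed.

(** The growth condition is continuity at infinity, read through [nbhs_infty]. *)
Lemma omap_continuous (p : C -> C) : continuous p ->
  (forall r, exists s, forall z, s < cmod z -> r < cmod (p z)) ->
  continuous (omap p : S2 -> S2).
Proof.
move=> cp pr [z|] U.
  by move=> /nbhs_someP Uz; apply/nbhs_someP; exact: (cp z _ Uz).
move=> /nbhs_infty[UN [r Ur]]; apply/nbhs_infty; split => //.
by have [s sP] := pr r; exists s => z /sP; exact: Ur.
Qed.

Definition sphere_inv (u : S2) : S2 :=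
  if u is Some z then if z == 0 then None else Some z^-1 else Some 0.

Lemma sphere_invK : involutive sphere_inv.
Proof.
case=> [z|] /=; last by rewrite eqxx.
have [->//|z0] := eqVneq z 0.
by rewrite /= invr_eq0 (negPf z0) invrK.
Qed.

Lemma sphere_inv_continuous : continuous sphere_inv.
Proof.
case=> [z|] U /=.
  have [->|z0] := eqVneq z 0.
    move=> /nbhs_infty[UN [r Ur]].
    (* The radius [r] may be negative or zero, so it is replaced by a larger positive one that can
       be inverted. *)
    pose q : R := `|r| + 1; have q0 : 0 < q by rewrite ltr_wpDl.
    apply/nbhs_someP; near=> w => /=; case: (eqVneq w 0) => [//|w0].
    apply: Ur; rewrite cmodV.
    have wq : cmod (0 - w) < q^-1 by near: w; apply: near_cmod;
      rewrite invr_gt0.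
    have {}wq : cmod w < q^-1.
      by move: wq; rewrite -ltcR -normE sub0r normrN normE ltcR.
    have wp : 0 < cmod w by rewrite cmod_gt0.
    have : q < (cmod w)^-1 by rewrite -(invrK q) ltf_pV2 // posrE // invr_gt0.
    by apply: le_lt_trans; rewrite (le_trans (ler_norm r)) // lerDl.
  move=> /nbhs_someP Uz; apply/nbhs_someP.
  have ci : {for z, continuous (fun w : C => w^-1)}.
    by apply: continuous_invC => //; exact: cvg_id.
  have {ci Uz} Uw := ci _ Uz.
  near=> w; have wz : cmod (z - w) < cmod z.
    by near: w; apply: near_cmod; rewrite cmod_gt0.
  rewrite /=; case: eqVneq => [w0|w0]; first by move: wz; rewrite w0 subr0 ltxx.
  by near: w; exact: Uw.
move=> /nbhs_someP /near_norm[e e0 eU].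
apply/nbhs_infty; split=> /=.
  by apply: eU; rewrite subrr /cmod /= !expr0n addr0 sqrtr0.
exists e^-1 => z ez; have z0 : z != 0.
  by rewrite -cmod_gt0; apply: lt_trans ez; rewrite invr_gt0.
rewrite (negPf z0); apply: eU.
rewrite -ltcR -normE sub0r normrN normE ltcR cmodV.
by rewrite -[ltRHS]invrK ltf_pV2 // posrE ?invr_gt0 // cmod_gt0.
Unshelve. all: by end_near. Qed.

Lemma affine_continuous (a b : C) : a != 0 ->
  continuous (omap (fun z => a * z + b) : S2 -> S2).
Proof.
move=> a0; apply: omap_continuous => [z|r].
  apply: (@continuous_addC R C (fun z => a * z) (fun=> b));
    last exact: cst_continuous.
  by apply: continuous_mulC; [exact: cst_continuous|exact: cvg_id].
have ca : 0 < cmod a by rewrite cmod_gt0.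
exists ((r + cmod b) / cmod a) => z;
  rewrite ltr_pdivrMr // -ltrBrDr => /lt_le_trans; apply.
have := lerB_normD (a * z) b; rewrite !normE -rmorphB lecR cmodM;
  apply: le_trans.
by rewrite mulrC.
Qed.

(* The default 0 is a junk value, taken where [h] is infinite. *)
Definition chart (h : S2 -> S2) z : C := odflt 0 (h (Some z)).

Lemma chart_continuous (h : S2 -> S2) : continuous h ->
  (forall z, h (Some z) <> None) -> continuous (chart h).
Proof.
move=> ch hN z U Uz.
have hS w : h (Some w) = Some (chart h w) by rewrite /chart; case: (h _) (hN w).
have /ch /nbhs_someP : nbhs (h (Some z)) (Some @` U).
  by rewrite hS; exact: one_point_compactification_some_nbhs.
apply: filterS => w /=; rewrite hS => -[u Uu [<-]] //.
Qed.

End Sphere.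

(** * Moebius maps, traces and multipliers *)

Section MobiusAlgebra.
Variable C : numClosedFieldType.
Implicit Types (A B P : 'M[C]_2) (x y z k l t mu nu : C) (f g h : sphere C -> sphere C).

Definition mx2 (a b c d : C) : 'M[C]_2 :=
  \matrix_(i, j) if i == 0 then if j == 0 then a else b
                 else if j == 0 then c else d.

Lemma ord2P (i : 'I_2) : i = 0 \/ i = 1.
Proof. by case: i => [[|[|]]] // ?; [left|right]; apply: val_inj. Qed.

Lemma mx2E A : A = mx2 (A 0 0) (A 0 1) (A 1 0) (A 1 1).
Proof.
by apply/matrixP=> i j; rewrite mxE; case: (ord2P i) => ->;
  case: (ord2P j) => ->.
Qed.

Lemma det2E A : \det A = A 0 0 * A 1 1 - A 0 1 * A 1 0.
Proof.
have l0 : lift 0 0 = 1 :> 'I_2 by apply: val_inj.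
have l1 : lift 1 0 = 0 :> 'I_2 by apply: val_inj.
rewrite (expand_det_row _ 0) !big_ord_recl big_ord0 /cofactor !det_mx11 !mxE l0 l1 /=.
by rewrite /bump /= expr0 expr1; ring.
Qed.

Lemma tr2E A : \tr A = A 0 0 + A 1 1.
Proof. by rewrite /mxtrace !big_ord_recl big_ord0 addr0; congr (_ + A _ _);
  apply: val_inj. Qed.

Lemma mulmx2E A B i j : (A *m B) i j = A i 0 * B 0 j + A i 1 * B 1 j.
Proof.
rewrite mxE !big_ord_recl big_ord0 addr0; congr (_ + A _ _ * B _ _);
  exact: val_inj.
Qed.

(* The point of the sphere with homogeneous coordinates [x : y]. *)
Definition pt x y : sphere C := if y == 0 then None else Some (x / y).

Lemma ptZ k x y : k != 0 -> pt (k * x) (k * y) = pt x y.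
Proof.
move=> k0; rewrite /pt mulf_eq0 (negPf k0) /=; case: eqVneq => // y0.
by congr Some; field; rewrite k0 y0.
Qed.

(** In homogeneous coordinates the map is linear and infinity is no longer exceptional; composition
    therefore becomes the matrix product. *)
Lemma mobius_pt A x y : \det A != 0 -> (x != 0) || (y != 0) ->
  mobius A (pt x y) = pt (A 0 0 * x + A 0 1 * y) (A 1 0 * x + A 1 1 * y).
Proof.
move=> dA; rewrite {1}/pt; case: (eqVneq y 0) => [->|y0] /=.
  rewrite orbF !mulr0 !addr0 => x0; rewrite ![_ * x]mulrC.
  by rewrite ptZ.
move=> _; rewrite -/(pt _ _) -(ptZ _ _ (y0)).
by congr pt; field.
Qed.

Lemma mobius_none A : mobius A None = pt (A 0 0) (A 1 0).
Proof. by []. Qed.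

Lemma mobius_some A z : mobius A (Some z) = pt (A 0 0 * z + A 0 1) (A 1 0 * z + A 1 1).
Proof. by []. Qed.

Lemma mobiusM A B : \det A != 0 -> \det B != 0 ->
  mobius (A *m B) = mobius A \o mobius B.
Proof.
move=> dA dB; apply/funext => -[z|]; rewrite compE.
  rewrite !mobius_some mobius_pt //.
    by rewrite !mulmx2E; congr pt; ring.
  rewrite -negb_and; apply: contra dB => /andP[/eqP e1 /eqP e2]; rewrite det2E.
  apply/eqP;
    transitivity (B 0 0 * (B 1 0 * z + B 1 1) - B 1 0 * (B 0 0 * z + B 0 1)).
    by ring.
  by rewrite e1 e2 !mulr0 subrr.
rewrite !mobius_none mobius_pt //; first by rewrite !mulmx2E.
rewrite -negb_and; apply: contra dB => /andP[/eqP e1 /eqP e2].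
by rewrite det2E e1 e2 mul0r mulr0 subrr.
Qed.

Lemma mobius1 : mobius (1%:M : 'M[C]_2) = id.
Proof.
apply/funext => -[z|]; rewrite ?mobius_some ?mobius_none /pt !mxE /= ?eqxx //.
by rewrite mul0r mul1r addr0 add0r oner_eq0 divr1.
Qed.

Lemma mobiusZ k A : k != 0 -> mobius (k *: A) = mobius A.
Proof.
move=> k0; apply/funext => -[z|];
  rewrite ?mobius_some ?mobius_none !mxE ?ptZ //.
by rewrite -!mulrA -!mulrDr ptZ.
Qed.

(** The values at infinity, 0 and 1 force in turn c = 0, b = 0 and a = d. *)
Lemma mobius_id A : \det A != 0 -> mobius A = id -> exists2 k, k != 0 & A = k%:M.
Proof.
move=> dA Aid.
have c0 : A 1 0 = 0.
  by have := congr1 (@^~ None) Aid; rewrite mobius_none /pt; case: eqVneq.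
have d0 : A 1 1 != 0 by apply: contraNneq dA => d0;
  rewrite det2E c0 d0 !mulr0 subrr.
have A1 z : A 0 0 * z + A 0 1 = z * A 1 1.
  have := congr1 (@^~ (Some z)) Aid;
    rewrite mobius_some /pt c0 mul0r add0r (negPf d0).
  by case=> {2}<-; rewrite divfK.
have b0 : A 0 1 = 0 by have := A1 0; rewrite mulr0 mul0r add0r.
have ad : A 0 0 = A 1 1 by have := A1 1; rewrite b0 mulr1 mul1r addr0.
exists (A 1 1) => //; rewrite [A]mx2E b0 c0 ad; apply/matrixP => i j;
  rewrite !mxE.
by case: (ord2P i) => ->; case: (ord2P j) => ->.
Qed.

Lemma mobiusK A : \det A != 0 ->
  cancel (mobius A) (mobius (invmx A)) /\ cancel (mobius (invmx A)) (mobius A).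
Proof.
move=> dA; have uA : A \in unitmx by rewrite unitmxE unitfE.
have dV : \det (invmx A) != 0 by rewrite det_inv invr_eq0.
split=> z.
  by rewrite -[LHS]/((mobius (invmx A) \o mobius A) z) -mobiusM // mulVmx // mobius1.
by rewrite -[LHS]/((mobius A \o mobius (invmx A)) z) -mobiusM // mulmxV // mobius1.
Qed.

Lemma mobius_inj A B : \det A != 0 -> \det B != 0 -> mobius A = mobius B ->
  exists2 k, k != 0 & A = k *: B.
Proof.
move=> dA dB AB; have uB : B \in unitmx by rewrite unitmxE unitfE.
have dV : \det (invmx B) != 0 by rewrite det_inv invr_eq0.
have [||k k0 kE] := @mobius_id (invmx B *m A).
- by rewrite det_mulmx mulf_neq0.
- by rewrite mobiusM // AB; apply/funext => z /=; rewrite (mobiusK dB).1.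
by exists k => //; rewrite -[A](mulKVmx uB) kE mul_mx_scalar.
Qed.

Definition model_mx nu : 'M[C]_2 := if nu == 1 then mx2 1 1 0 1 else mx2 nu 0 0 1.

Lemma model_mapE nu : nu != 0 -> model_map nu = mobius (model_mx nu).
Proof.
move=> nu0; apply/funext => -[z|];
  rewrite ?mobius_some ?mobius_none /pt /model_mx /=.
  by case: eqVneq => _;
    rewrite !mxE /= mul0r add0r oner_eq0 divr1 ?mul1r ?addr0.
by case: (eqVneq nu 1) => _; rewrite !mxE /= eqxx.
Qed.

Lemma det_model_mx nu : \det (model_mx nu) = if nu == 1 then 1 else nu.
Proof.
by rewrite det2E /model_mx; case: eqVneq => _;
  rewrite !mxE /= ?mulr1 ?mulr0 ?mul0r subr0.
Qed.

Lemma det_model_mx_neq0 nu : nu != 0 -> \det (model_mx nu) != 0.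
Proof. by move=> nu0; rewrite det_model_mx; case: ifP => // _;
  exact: oner_neq0. Qed.

(** Both sides are homogeneous of degree 2 in the matrix, so the relation survives rescaling, and it
    covers translation and multiplication alike. *)
Lemma tr_model_mx nu : nu * \tr (model_mx nu) ^+ 2 = (nu + 1) ^+ 2 * \det (model_mx nu).
Proof.
rewrite det_model_mx tr2E /model_mx; case: eqVneq => [->|_]; rewrite !mxE /=;
  ring.
Qed.

(** A conjugacy of maps is a similarity of matrices up to a factor [k], which scales the trace by k
    and the determinant by k^2. The relation for the model matrix thus passes to A, and dividing by
    a root of the determinant normalizes it. It is symmetric under inversion of the multiplier. *)
Lemma multiplier_tr f M mu : mobius_matrix f M -> multiplier f mu ->
  mu != 0 /\ (mu + 1) ^+ 2 = mu * \tr M ^+ 2.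
Proof.
case=> A [dA fA ->] [nu [nu0 [h [h' [[P [dP hP]] hK h'K nuE]]] mu_nu]].
have nuT : (nu + 1) ^+ 2 = nu * \tr ((sqrtC (\det A))^-1 *: A) ^+ 2.
  have uP : P \in unitmx by rewrite unitmxE unitfE.
  have [|||k k0 PD] := @mobius_inj (P *m model_mx nu) (A *m P).
  - by rewrite det_mulmx mulf_neq0 ?det_model_mx_neq0.
  - by rewrite det_mulmx mulf_neq0.
  - rewrite !mobiusM ?det_model_mx_neq0 // -model_mapE // -hP -fA nuE.
    by apply/funext => z /=; rewrite h'K.
  have DE : model_mx nu = k *: (invmx P *m A *m P).
    by rewrite -[LHS](mulKmx uP) PD -scalemxAr mulmxA.
  have trD : \tr (model_mx nu) = k * \tr A.
    by rewrite DE mxtraceZ mxtrace_mulC mulmxA mulmxV // mul1mx.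
  have detD : \det (model_mx nu) = k ^+ 2 * \det A.
    rewrite DE detZ !det_mulmx det_inv; congr (_ * _).
    by rewrite mulrAC mulVf // mul1r.
  have := tr_model_mx nu; rewrite trD detD => e;
    rewrite mxtraceZ exprMn exprVn sqrtCK.
  have k20 : k ^+ 2 != 0 by rewrite expf_neq0.
  apply: (mulIf dA); apply: (mulfI k20).
  transitivity (nu * (k * \tr A) ^+ 2); first by rewrite e; ring.
  by field.
case: mu_nu => ->; first by [].
split; first by rewrite invr_eq0.
apply: (mulfI (expf_neq0 2 nu0)).
transitivity ((nu + 1) ^+ 2); first by field.
by rewrite nuT; field.
Qed.

(** This is the Jordan form of A up to a scalar: [P] has eigenvectors or a Jordan chain as columns,
    and [nu] is the quotient of the eigenvalues. *)
Lemma multiplier_exists f : is_mobius f -> f <> id ->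
  exists2 nu, nu != 0 & mobius_conjugate f (model_map nu).
Proof.
case=> A [dA fA] fid.
suff [nu [P [k [nu0 dP k0 APE]]]] : exists nu P k,
    [/\ nu != 0, \det P != 0, k != 0 & A *m P = k *: (P *m model_mx nu)].
  exists nu => //; exists (mobius P), (mobius (invmx P)).
  have [PK KP] := mobiusK dP; split=> //; first by exists P.
  have dD := det_model_mx_neq0 nu0.
  have : mobius A \o mobius P = mobius P \o model_map nu.
    by rewrite model_mapE // -!mobiusM // APE mobiusZ.
  move=> e; apply/funext => z; have := congr1 (@^~ z) e.
  by rewrite fA /comp => ->; rewrite PK.
have [l1 [l2 [trl detl]]] : exists l1 l2, l1 + l2 = \tr A /\ l1 * l2 = \det A.
  pose s := sqrtC (\tr A ^+ 2 - 4 * \det A).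
  exists ((\tr A + s) / 2), ((\tr A - s) / 2); split; first by field.
  transitivity ((\tr A ^+ 2 - s ^+ 2) / 4); first by field.
  by rewrite sqrtCK; field.
have l10 : l1 != 0 by apply: contraNneq dA => l0; rewrite -detl l0 mul0r.
have l20 : l2 != 0 by apply: contraNneq dA => l0; rewrite -detl l0 mulr0.
pose a := A 0 0; pose b := A 0 1; pose c := A 1 0; pose d := A 1 1.
have AE : A = mx2 a b c d := mx2E A.
have det_mx2 p q r s : \det (mx2 p q r s) = p * s - q * r by rewrite det2E !mxE.
have eq_mx2 (B1 B2 : 'M[C]_2) : B1 0 0 = B2 0 0 -> B1 0 1 = B2 0 1 ->
   B1 1 0 = B2 1 0 -> B1 1 1 = B2 1 1 -> B1 = B2.
  by move=> e1 e2 e3 e4; rewrite [B1]mx2E e1 e2 e3 e4 -mx2E.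
have td : l1 + l2 = a + d by rewrite trl tr2E.
have dd : l1 * l2 = a * d - b * c by rewrite detl det2E.
have bc : b * c = a * d - l1 * l2 by rewrite dd; ring.
have dE : d = l1 + l2 - a by rewrite td; ring.
have [c0|c0] := eqVneq c 0; last first.
  have [ll|ll] := eqVneq l1 l2.
    (* Jordan chain for a double eigenvalue l: the second column is v = (1, 0), and the first one is
       the eigenvector (A - l) v / l. *)
    exists 1, (mx2 ((a - l1) / l1) 1 (c / l1) 0), l1; split=> //.
    - by rewrite det_mx2 mulr0 mul1r sub0r oppr_eq0 mulf_neq0 ?invr_eq0.
    - rewrite AE /model_mx eqxx; apply: eq_mx2;
        rewrite [RHS]mxE !mulmx2E !mxE /=.
      + by rewrite mulrA [b * (_ / _)]mulrA bc dE -ll; field.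
      + by field.
      + by rewrite dE -ll; field.
      + by field.
  (* For c nonzero, (l - d, c) is an eigenvector for the eigenvalue l. *)
  exists (l1 / l2), (mx2 (l1 - d) (l2 - d) c c), l2; split=> //.
  - by rewrite mulf_neq0 ?invr_eq0.
  - rewrite det_mx2 (_ : _ - _ = c * (l1 - l2)); last by ring.
    by rewrite mulf_neq0 // subr_eq0.
  - have nu1 : l1 / l2 != 1 by apply: contra_neq ll => /divr1_eq.
    rewrite AE /model_mx (negPf nu1); apply: eq_mx2;
      rewrite [RHS]mxE !mulmx2E !mxE /=.
    + by rewrite bc dE; field.
    + by rewrite bc dE; field.
    + by field.
    + by field.
have ad0 : a * d != 0 by apply: contraNneq dA => ad;
  rewrite det2E -/a -/b -/c -/d ad c0 mulr0 subrr.
have [a0 d0] : a != 0 /\ d != 0 by apply/andP; rewrite -negb_or -mulf_eq0.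
have [ad|ad] := eqVneq a d.
  (* With b = c = 0 and a = d the matrix would be scalar and the map the identity. *)
  have b0 : b != 0.
    apply: contra_notN fid => /eqP b0; rewrite fA -mobius1 -(mobiusZ 1%:M a0).
    congr mobius; rewrite AE b0 c0 -ad; apply: eq_mx2; rewrite !mxE /=; ring.
  exists 1, (mx2 (b / a) 0 0 1), a; split=> //.
  - by rewrite det_mx2 mulr0 subr0 mulr1 mulf_neq0 ?invr_eq0.
  - by rewrite AE c0 -ad /model_mx eqxx; apply: eq_mx2;
      rewrite [RHS]mxE !mulmx2E !mxE /=; field.
(* The columns (1, 0) and (b, d - a) are eigenvectors of the triangular matrix for a and d. *)
exists (a / d), (mx2 1 b 0 (d - a)), d; split=> //.
- by rewrite mulf_neq0 ?invr_eq0.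
- by rewrite det_mx2 mulr0 subr0 mul1r subr_eq0 eq_sym.
- have nu1 : a / d != 1 by apply: contra_neq ad => /divr1_eq.
  by rewrite AE c0 /model_mx (negPf nu1); apply: eq_mx2;
    rewrite [RHS]mxE !mulmx2E !mxE /=; field.
Qed.

Lemma eigenvalue2 A l : eigenvalue A l = (l ^+ 2 - \tr A * l + \det A == 0).
Proof.
rewrite /eigenvalue /eigenspace kermx_eq0 row_free_unit unitmxE unitfE negbK.
rewrite !det2E tr2E !mxE /=; congr (_ == 0); ring.
Qed.

Lemma mobius_matrix_det f M : mobius_matrix f M -> \det M = 1.
Proof.
case=> A [dA _ ->]; rewrite detZ exprVn sqrtCK mulVf //.
Qed.

(** The other root is 1/l, so t = l + 1/l, which is l + conj l when l is unimodular. Conversely, for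
    real t the conjugate of l is a root too. Either it is the other root, and l conj l = 1, or l is
    real; then t^2 - 4 = (2l - t)^2 is both nonpositive and nonnegative, and l is 1 or -1. *)
Lemma unimodular_root_trace l t : l ^+ 2 - t * l + 1 = 0 ->
  (`|l| == 1) = (-2 <= t <= 2).
Proof.
move=> e; have l0 : l != 0.
  by apply: contra_eqN e => /eqP ->; rewrite expr0n mulr0 subr0 add0r oner_eq0.
have tE : t = l + l^-1.
  apply: (mulIf l0); rewrite mulrDl mulVf // -expr2.
  by apply/eqP; rewrite -subr_eq0 -oppr_eq0; apply/eqP; rewrite -e; ring.
apply/eqP/idP => [l1|/andP[t1 t2]].
  have lV : l^-1 = l^* by rewrite invC_norm l1 expr1n invr1 mul1r.
  have tr : t \is Num.real by rewrite CrealE tE lV rmorphD /= conjCK addrC.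
  rewrite -real_ler_norml // tE; apply: le_trans (ler_normD _ _) _.
  by rewrite normfV l1 invr1.
(* The order is partial: being comparable with a real number forces [t] to be real. *)
have tr : t \is Num.real by rewrite (ger_real t1) rpredN realn.
have e' : l^* ^+ 2 - t * l^* + 1 = 0.
  by have := congr1 (@Num.conj C) e;
    rewrite rmorphD rmorphB rmorphXn rmorphM rmorph0 rmorph1 /= (CrealP tr).
have : (l - l^*) * (l + l^* - t) = 0.
  by rewrite -(subrr (0 : C)) -{1}e -e'; ring.
move/eqP; rewrite mulf_eq0 => /orP[/eqP ll|/eqP ll].
  have lr : l \is Num.real by rewrite CrealE eq_sym -subr_eq0 ll.
  have sq : (2 * l - t) ^+ 2 = t ^+ 2 - 4.
    transitivity (4 * (l ^+ 2 - t * l + 1) + (t ^+ 2 - 4)); first by ring.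
    by rewrite e mulr0 add0r.
  have t4 : t ^+ 2 <= 4.
    by rewrite -real_normK // -[4](_ : 2 ^+ 2 = _) ?ler_pXn2r ?nnegrE ?real_ler_norml ?t1 //; ring.
  have s0 : 2 * l - t = 0.
    apply/eqP; rewrite -sqrf_eq0 eq_le {1}sq subr_le0 t4 /=.
    by rewrite real_exprn_even_ge0 // rpredB ?rpredM ?realn.
  have l2 : l ^+ 2 = 1.
    have t2l : t = 2 * l by apply/esym/eqP; rewrite -subr_eq0 s0.
    by apply/eqP; rewrite -subr_eq0 -oppr_eq0; apply/eqP; rewrite -e t2l; ring.
  by apply/eqP; rewrite -(@pexpr_eq1 _ _ 2) // -normrX l2 normr1.
have lc : l * l^* = 1.
  have -> : l^* = t - l by apply/eqP; rewrite -subr_eq0 -ll; apply/eqP; ring.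
  by apply/eqP; rewrite -subr_eq0 -oppr_eq0; apply/eqP; rewrite -e; ring.
by apply/eqP; rewrite -(@pexpr_eq1 _ _ 2) // normCK lc.
Qed.

(** For a square root s of [mu] the hypothesis reads (s^2 + 1)^2 = (t s)^2, so s or -s solves the
    quadratic equation. *)
Lemma multiplier_root mu t : (mu + 1) ^+ 2 = mu * t ^+ 2 ->
  exists2 l, l ^+ 2 = mu & l ^+ 2 - t * l + 1 = 0.
Proof.
move=> e; pose s := sqrtC mu; have s2 : s ^+ 2 = mu by exact: sqrtCK.
have : (s ^+ 2 - t * s + 1) * ((- s) ^+ 2 - t * (- s) + 1) = 0.
  transitivity ((s ^+ 2 + 1) ^+ 2 - s ^+ 2 * t ^+ 2); first by ring.
  by rewrite s2 e subrr.
move/eqP; rewrite mulf_eq0 => /orP[]/eqP; [exists s|exists (- s)] => //.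
by rewrite sqrrN.
Qed.

Lemma multiplier_norm mu t : (mu + 1) ^+ 2 = mu * t ^+ 2 -> -2 <= t <= 2 ->
  `|mu| = 1.
Proof.
move=> e t2; have [l <- el] := multiplier_root e.
by rewrite normrX (eqP (etrans (unimodular_root_trace el) t2)) expr1n.
Qed.

Lemma multiplier_trace_eq mu nu t u : mu != 0 -> nu != 0 ->
  (mu + 1) ^+ 2 = mu * t ^+ 2 -> (nu + 1) ^+ 2 = nu * u ^+ 2 ->
  mu = nu \/ mu = nu^-1 -> t = u \/ t = - u.
Proof.
move=> mu0 nu0 et eu mn; have : t ^+ 2 = u ^+ 2.
  have tE : t ^+ 2 = (mu + 1) ^+ 2 / mu by rewrite et mulrC mulKf.
  have uE : u ^+ 2 = (nu + 1) ^+ 2 / nu by rewrite eu mulrC mulKf.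
  by rewrite tE uE; case: mn => -> //; field.
by move/eqP; rewrite eqf_sqr => /orP[]/eqP; [left|right].
Qed.

Lemma topologically_conjugate_sym f g :
  topologically_conjugate f g -> topologically_conjugate g f.
Proof.
move=> [h [h' [[hK h'K ch ch'] ->]]]; exists h', h; split=> //.
by apply/funext => z /=; rewrite !h'K.
Qed.

Lemma topologically_conjugate_trans f g h :
  topologically_conjugate f g -> topologically_conjugate g h ->
  topologically_conjugate f h.
Proof.
move=> [k [k' [[kK k'K ck ck'] ->]]] [u [u' [[uK u'K cu cu'] ->]]].
exists (k \o u), (u' \o k'); split=> //; split.
- by move=> z /=; rewrite kK uK.
- by move=> z /=; rewrite u'K k'K.
- by move=> z; apply: continuous_comp; [exact: cu|exact: ck].
- by move=> z; apply: continuous_comp; [exact: ck'|exact: cu'].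
Qed.

End MobiusAlgebra.

(** * Conjugacies between normal forms *)

Section Conjugacies.
Variable R : realType.
Local Notation C := (Cx R).
Local Notation Re := (@complex.Re R).
Local Notation Im := (@complex.Im R).
Local Notation S2 := (sphere C).
Implicit Types (z w mu nu : C) (x y : R) (f g h : S2 -> S2).

Lemma mobius_continuous (A : 'M[C]_2) : \det A != 0 -> continuous (mobius A : S2 -> S2).
Proof.
move=> dA; pose a := A 0 0; pose b := A 0 1; pose c := A 1 0; pose d := A 1 1.
have dE : \det A = a * d - b * c := det2E A.
have [c0|c0] := eqVneq c 0.
  have [a0 d0] : a != 0 /\ d != 0.
    by apply/andP; rewrite -negb_or -mulf_eq0; apply: contra dA => /eqP ad;
      rewrite dE ad c0 mulr0 subrr.
  have -> : mobius A = omap (fun z => a / d * z + b / d).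
    apply/funext => -[z|];
      rewrite ?mobius_some ?mobius_none /pt -/a -/b -/c -/d c0 /=.
      by rewrite mul0r add0r (negPf d0); congr Some; field.
    by rewrite eqxx.
  by apply: affine_continuous; rewrite mulf_neq0 ?invr_eq0.
(* For c nonzero, (a z + b)/(c z + d) = a/c + k/(c z + d): an affine map, the inversion, and another
   affine map. *)
pose k := (b * c - a * d) / c.
have k0 : k != 0 by rewrite mulf_neq0 ?invr_eq0 // -oppr_eq0 opprB -dE.
have -> : mobius A = omap (fun z => k * z + a / c) \o (@sphere_inv R) \o omap (fun z => c * z + d).
  apply/funext => -[z|];
    rewrite ?mobius_some ?mobius_none /pt -/a -/b -/c -/d /=.
    by case: eqVneq => //= e; congr Some; rewrite /k; field; rewrite ?e ?c0.
  by rewrite (negPf c0) mulr0 add0r.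
move=> u; apply: (@continuous_comp S2 S2 S2); first exact: affine_continuous.
apply: (@continuous_comp S2 S2 S2); first exact: sphere_inv_continuous.
exact: affine_continuous.
Qed.

Lemma mobius_conjugate_top f g : mobius_conjugate f g -> topologically_conjugate f g.
Proof.
move=> [h [h' [[P [dP hP]] hK h'K gE]]]; exists h, h'; split=> //; split=> //.
  by rewrite hP; exact: mobius_continuous.
have -> : h' = mobius (invmx P).
  apply/funext => z; rewrite -{1}((mobiusK dP).2 z) -[X in h' X]/(mobius P _).
  by rewrite -hP hK.
by apply: mobius_continuous; rewrite det_inv invr_eq0.
Qed.

Lemma model_map_some nu z : model_map nu (Some z) = Some (if nu == 1 then z + 1 else nu * z).
Proof. by []. Qed.

Lemma model_mapV nu : nu != 0 -> nu != 1 ->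
  model_map nu^-1 = @sphere_inv R \o model_map nu \o @sphere_inv R.
Proof.
move=> nu0 nu1; apply/funext => -[z|].
  rewrite /comp model_map_some /= invr_eq1 (negPf nu1).
  have [->|z0] := eqVneq z 0; first by rewrite mulr0.
  rewrite /= (negPf nu1) mulf_eq0 (negPf nu0) invr_eq0 (negPf z0) /=.
  by rewrite invfM invrK.
by rewrite /comp /= (negPf nu1) mulr0 eqxx.
Qed.

Lemma model_map_inv nu : nu != 0 -> nu != 1 ->
  topologically_conjugate (model_map nu : S2 -> S2) (model_map nu^-1).
Proof.
move=> nu0 nu1; exists (@sphere_inv R), (@sphere_inv R).
split; last exact: model_mapV.
by split; [exact: sphere_invK..|exact: sphere_inv_continuous|
           exact: sphere_inv_continuous].
Qed.

Lemma conj_continuous : continuous (Num.conj : C -> C).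
Proof.
have -> : (Num.conj : C -> C) = fun z => cplx (Re z) (- Im z) by apply/funext;
  case.
move=> z; apply: (@cvg_cplx R C (nbhs z)); first exact: Re_continuous.
by apply: (@cvgN _ R^o C (nbhs z)); exact: Im_continuous.
Qed.

Lemma cmod_conj z : cmod z^* = cmod z.
Proof. by apply: complexI; rewrite -!normE norm_conjC. Qed.

Lemma model_map_conj nu :
  topologically_conjugate (model_map nu : S2 -> S2) (model_map nu^*).
Proof.
have cc : continuous (omap Num.conj : S2 -> S2).
  apply: omap_continuous; first exact: conj_continuous.
  by move=> r; exists r => z; rewrite cmod_conj.
have cK : involutive (omap Num.conj : S2 -> S2).
  by case=> [z|] //=; rewrite conjCK.
exists (omap Num.conj), (omap Num.conj); split; first by split.
apply/funext => -[z|] //=; congr Some; rewrite fmorph_eq1.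
by case: ifP => _; rewrite ?rmorphD ?rmorphM /= conjCK ?rmorph1.
Qed.

(* The junk value [ln 0] is harmless: it is multiplied by [z = 0]. *)
Definition spiral w z : C := z * cexp (w * (ln (cmod z))%:C%C).

Lemma Re_mulr w x : Re (w * x%:C%C) = Re w * x.
Proof. by case: w => a b /=; rewrite mulr0 subr0. Qed.

Lemma cmod_spiral w z : z != 0 -> cmod (spiral w z) = expR ((1 + Re w) * ln (cmod z)).
Proof.
move=> z0; rewrite cmodM cmod_cexp Re_mulr mulrDl mul1r expRD lnK //.
by rewrite posrE cmod_gt0.
Qed.

(** Multiplicativity is what makes [spiral w] carry multiplication by [nu] to multiplication by
    [spiral w nu]. *)
Lemma spiralM w z1 z2 : spiral w (z1 * z2) = spiral w z1 * spiral w z2.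
Proof.
rewrite /spiral; have [->|z10] := eqVneq z1 0; first by rewrite !mul0r.
have [->|z20] := eqVneq z2 0; first by rewrite mulr0 !mul0r mulr0.
by rewrite cmodM lnM ?posrE ?cmod_gt0 // rmorphD mulrDr cexpD; ring.
Qed.

(** The modulus of [spiral w z] is |z| to the power 1 + Re w, and a positive exponent makes it tend
    to 0 at the origin. *)
Lemma spiral_continuous w : 0 < 1 + Re w -> continuous (spiral w).
Proof.
move=> b0 z; have [->|z0] := eqVneq z 0.
  rewrite /continuous_at {2}/spiral mul0r;
    apply: (@cvg_cmodP R C (nbhs (0 : C))) => e e0.
  near=> u; have [->|u0] := eqVneq u 0;
    first by rewrite /spiral mul0r subrr (eqP (etrans (cmod_eq0 _) (eqxx _))).
  rewrite -ltcR -normE sub0r normrN normE ltcR cmod_spiral //.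
  rewrite -ltr_ln ?posrE ?expR_gt0 // expRK mulrC -ltr_pdivlMr //.
  rewrite -ltr_expR lnK ?posrE ?cmod_gt0 //.
  have : cmod (0 - u) < expR (ln e / (1 + Re w)).
    by near: u; apply: near_cmod; exact: expR_gt0.
  by rewrite -ltcR -normE sub0r normrN normE ltcR.
apply: (@continuous_mulC R C id (fun z => cexp (w * (ln (cmod z))%:C%C)));
  first exact: cvg_id.
apply: (@continuous_comp C C C _ (@cexp R)); last exact: cexp_continuous.
apply: (@continuous_mulC R C (fun=> w) (fun z => (ln (cmod z))%:C%C : C)).
  exact: cst_continuous.
apply: (@cvg_cplx R C (nbhs z)); last exact: cvg_cst.
apply: (@continuous_comp C R R _ (@ln R)); first exact: cmod_continuous.
by apply: continuous_ln; rewrite cmod_gt0.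
Unshelve. all: by end_near. Qed.

Lemma spiral_coercive w r : 0 < 1 + Re w ->
  exists s, forall z, s < cmod z -> r < cmod (spiral w z).
Proof.
move=> b0; have r1 : 0 < `|r| + 1 by rewrite ltr_wpDl.
exists (expR (ln (`|r| + 1) / (1 + Re w))) => z sz.
have z0 : 0 < cmod z by apply: lt_trans sz; exact: expR_gt0.
apply: (@lt_trans _ _ (`|r| + 1));
  first by rewrite (le_lt_trans (ler_norm r)) // ltrDl.
rewrite cmod_spiral -?cmod_gt0 // -[ltLHS]lnK ?posrE // ltr_expR mulrC -ltr_pdivrMr //.
by rewrite -ltr_expR lnK.
Qed.

(** The spiral multiplies ln|z| by 1 + Re w, so an inverse exponent [v] has to satisfy v (1 + Re w)
    = -w. *)
Lemma spiralK w v : 0 < 1 + Re w -> v = - w * ((1 + Re w)^-1)%:C%C ->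
  cancel (spiral w) (spiral v).
Proof.
move=> b0 vE z; have [->|z0] := eqVneq z 0; first by rewrite /spiral !mul0r.
have vw : v * (1 + Re w)%:C%C = - w.
  by rewrite vE -mulrA -rmorphM mulVf ?gt_eqF // mulr1.
rewrite {1}/spiral cmod_spiral // expRK {1}/spiral -mulrA -cexpD.
by rewrite [(_ * ln _)%:C%C]rmorphM mulrA vw mulNr subrr cexp0 mulr1.
Qed.

Lemma loxodromic_conjugate mu nu : mu != 0 -> nu != 0 ->
  cmod mu != 1 -> cmod nu != 1 ->
  topologically_conjugate (model_map mu : S2 -> S2) (model_map nu).
Proof.
have neq1 (u : C) : cmod u != 1 -> u != 1 by apply: contra_neq => ->;
  rewrite cmod1.
(* Inverting multipliers where necessary brings both moduli above 1. Then 1 + Re w = ln|mu| / ln|nu|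
   is positive, as the spiral requires. *)
wlog mu1 : mu / 1 < cmod mu => [H|] mu0 nu0 m1 n1.
  have [mu1|mu1|/eqP] := ltgtP 1 (cmod mu); [exact: H|..];
    last by rewrite eq_sym (negPf m1).
  apply: topologically_conjugate_trans (model_map_inv mu0 (neq1 _ m1)) _.
  have c0 : 0 < cmod mu by rewrite cmod_gt0.
  apply: H; rewrite ?invr_eq0 ?cmodV ?invr_eq1 //.
  by rewrite invf_gt1.
wlog nu1 : nu nu0 n1 / 1 < cmod nu => [H|].
  have [nu1|nu1|/eqP] := ltgtP 1 (cmod nu); [exact: H|..];
    last by rewrite eq_sym (negPf n1).
  apply: topologically_conjugate_sym.
  apply: topologically_conjugate_trans (model_map_inv nu0 (neq1 _ n1)) _.
  apply: topologically_conjugate_sym.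
  have c0 : 0 < cmod nu by rewrite cmod_gt0.
  apply: H; rewrite ?invr_eq0 ?cmodV ?invr_eq1 //.
  by rewrite invf_gt1.
have [xi xiE] := cexp_surj (mulf_neq0 mu0 (invr_neq0 nu0)).
have ln_mu : 0 < ln (cmod mu) by rewrite ln_gt0.
have ln_nu : 0 < ln (cmod nu) by rewrite ln_gt0.
have rxi : Re xi = ln (cmod mu) - ln (cmod nu).
  rewrite -[LHS]expRK -cmod_cexp xiE cmodM cmodV.
  by rewrite ln_div ?posrE ?cmod_gt0.
(* Since [xi] is a logarithm of mu/nu, this choice solves nu exp(w ln|nu|) = mu. *)
pose w : C := xi * ((ln (cmod nu))^-1)%:C%C.
have b0 : 0 < 1 + Re w.
  rewrite Re_mulr rxi mulrBl divff ?gt_eqF // addrC subrK divr_gt0 //.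
pose v : C := - w * ((1 + Re w)^-1)%:C%C.
have bv : 1 + Re v = (1 + Re w)^-1.
  have -> : Re v = - (Re w * (1 + Re w)^-1).
    by rewrite /v mulNr -Re_mulr; case: (w * _).
  by field; rewrite gt_eqF.
have v0 : 0 < 1 + Re v by rewrite bv invr_gt0.
have wE : w = - v * ((1 + Re v)^-1)%:C%C.
  by rewrite bv invrK mulNr /v -mulrA -rmorphM mulVf ?gt_eqF // mulr1 opprK.
have wn : spiral w nu = mu.
  rewrite /spiral /w -mulrA -rmorphM mulVf ?gt_eqF // mulr1 xiE.
  by rewrite mulrC divfK.
exists (omap (spiral w)), (omap (spiral v)); split.
  split.
  - by case=> [z|] //=; rewrite (spiralK b0 erefl).
  - by case=> [z|] //=; rewrite (spiralK v0 wE).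
  - by apply: omap_continuous => [|r];
      [exact: spiral_continuous|exact: spiral_coercive].
  - by apply: omap_continuous => [|r];
      [exact: spiral_continuous|exact: spiral_coercive].
apply/funext => -[z|] //;
  rewrite /comp /= (negPf (neq1 _ m1)) (negPf (neq1 _ n1)).
by rewrite -{1}wn -spiralM (spiralK b0 erefl).
Qed.

Lemma fixed_model_map mu (u : S2) : mu != 0 -> model_map mu u = u <->
  u = None \/ (mu != 1 /\ u = Some 0).
Proof.
move=> mu0; case: u => [z|] /=; last by split=> // _; left.
case: eqVneq => [_|mu1]; split=> [[]|[//|[//]]].
- by move/(canRL (addKr _)); rewrite addNr => /eqP; rewrite oner_eq0.
- move/eqP;
    rewrite -subr_eq0 -{2}[z]mul1r -mulrBl mulf_eq0 subr_eq0 (negPf mu1) /=.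
  by move=> /eqP ->; right.
- by move=> _ [->]; rewrite mulr0.
Qed.

(** A multiplication fixes both 0 and infinity, a translation only infinity, and a conjugacy maps
    fixed points injectively to fixed points. *)
Lemma parabolic_conjugate mu : mu != 0 ->
  topologically_conjugate (model_map mu : S2 -> S2) (model_map 1) -> mu = 1.
Proof.
move=> mu0 [h [h' [[hK h'K _ _] e]]]; apply: contrapT => /eqP mu1.
have fixh u : model_map mu u = u -> h' u = None.
  move=> fu; have : model_map 1 (h' u) = h' u by rewrite e /comp h'K fu.
  by move/(fixed_model_map _ (oner_neq0 _)) => [|[]] //; rewrite eqxx.
have := fixh (Some 0); have := fixh None erefl.
rewrite /= (negPf mu1) mulr0 => <- /(_ erefl) /(can_inj h'K).
by [].
Qed.

(** The rotation theorem wants a unimodular multiplier on the source side: it is applied to [h] if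
    [nu] is unimodular and to [h'] if [mu] is. *)
Lemma conjugate_fixing_poles mu nu (h h' : S2 -> S2) :
  mu != 0 -> nu != 0 -> mu != 1 -> nu != 1 ->
  homeomorphic_inverses h h' -> (forall u, h (model_map nu u) = model_map mu (h u)) ->
  h None = None -> h (Some 0) = Some 0 ->
  [\/ cmod mu != 1 /\ cmod nu != 1, mu = nu | mu = nu^-1].
Proof.
move=> mu0 nu0 mu1 nu1 [hK h'K ch ch'] e hN h0.
have h'N : h' None = None by rewrite -{1}hN hK.
have h'0 : h' (Some 0) = Some 0 by rewrite -{1}h0 hK.
have finite (k k' : S2 -> S2) : cancel k k' -> k None = None -> forall z, k (Some z) <> None.
  by move=> kK kN z kz; have := kK (Some z); rewrite kz -kN kK.
have hS z : h (Some z) = Some (chart h z).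
  by rewrite /chart; case: (h _) (finite _ _ hK hN z).
have h'S z : h' (Some z) = Some (chart h' z).
  by rewrite /chart; case: (h' _) (finite _ _ h'K h'N z).
have cK z : chart h' (chart h z) = z.
  by apply: Some_inj; rewrite -h'S -hS hK.
have c'K z : chart h (chart h' z) = z.
  by apply: Some_inj; rewrite -hS -h'S h'K.
have c0 : chart h 0 = 0 by apply: Some_inj; rewrite -hS.
have c'0 : chart h' 0 = 0 by apply: Some_inj; rewrite -h'S.
have cn0 z : z != 0 -> chart h z != 0.
  by apply: contra_neq => /(congr1 (chart h')); rewrite cK c'0.
have c'n0 z : z != 0 -> chart h' z != 0.
  by apply: contra_neq => /(congr1 (chart h)); rewrite c'K c0.
have ce z : chart h (nu * z) = mu * chart h z.
  apply: Some_inj; have := e (Some z).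
  by rewrite hS !model_map_some (negPf mu1) (negPf nu1) hS.
have ce' z : chart h' (mu * z) = nu * chart h' z.
  by rewrite -{1}[z]c'K -ce cK.
have cc := chart_continuous ch (finite _ _ hK hN).
have cc' := chart_continuous ch' (finite _ _ h'K h'N).
have [n1|n1] := eqVneq (cmod nu) 1.
  have [->|->] := conjugate_rotations (fun z _ => cc z) (fun z _ => cc' z)
    cn0 c'n0 (fun z _ => cK z) (fun z _ => ce z) n1 mu0;
      by [constructor 2|constructor 3].
have [m1|m1] := eqVneq (cmod mu) 1; last by constructor 1.
have [->|->] := conjugate_rotations (fun z _ => cc' z) (fun z _ => cc z)
  c'n0 cn0 (fun z _ => c'K z) (fun z _ => ce' z) m1 nu0.
  by constructor 2.
by constructor 3; rewrite invrK.
Qed.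

Lemma conjugate_models mu nu : mu != 0 -> nu != 0 ->
  topologically_conjugate (model_map mu : S2 -> S2) (model_map nu) ->
  [\/ cmod mu != 1 /\ cmod nu != 1, mu = nu | mu = nu^-1].
Proof.
move=> mu0 nu0 tc.
have [nu1|nu1] := eqVneq nu 1.
  by move: tc; rewrite nu1 => /(parabolic_conjugate mu0) ->; constructor 2.
have [mu1|mu1] := eqVneq mu 1.
  move: tc;
    rewrite mu1 => /topologically_conjugate_sym /(parabolic_conjugate nu0) ->.
  by constructor 2.
have [h [h' [[hK h'K ch ch'] e]]] := tc.
have he u : h (model_map nu u) = model_map mu (h u) by rewrite e /comp h'K.
have poles u : model_map nu u = u -> h u = None \/ h u = Some 0.
  move=> nu_u; have : model_map mu (h u) = h u by rewrite -he nu_u.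
  by move/(fixed_model_map _ mu0) => [|[_]]; [left|right].
have hN := poles None erefl.
have h0 : h (Some 0) = None \/ h (Some 0) = Some 0.
  by apply: poles; rewrite model_map_some (negPf nu1) mulr0.
have neq : h None <> h (Some 0) by move/(can_inj hK).
case: hN h0 => hN [h0|h0]; rewrite ?hN ?h0 // in neq *.
  exact: (@conjugate_fixing_poles mu nu h h').
(* Here [h] swaps 0 and infinity. Followed by the inversion it fixes both, at the price of replacing
   [mu] by its inverse. *)
have muV := model_mapV mu0 mu1.
have [||||||||[c1 c2]|<-|mn] := @conjugate_fixing_poles mu^-1 nu (@sphere_inv R \o h) (h' \o @sphere_inv R).
- by rewrite invr_eq0.
- by [].
- by rewrite invr_eq1.
- by [].
- split.
  + by move=> u; rewrite /comp sphere_invK hK.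
  + by move=> u; rewrite /comp h'K sphere_invK.
  + by move=> u; apply: (@continuous_comp S2 S2 S2);
      [exact: ch|exact: sphere_inv_continuous].
  + by move=> u; apply: (@continuous_comp S2 S2 S2);
      [exact: sphere_inv_continuous|exact: ch'].
- by move=> u; rewrite muV /comp sphere_invK he.
- by rewrite /comp hN /= eqxx.
- by rewrite /comp h0.
- by constructor 1; split=> //; move: c1; rewrite cmodV invr_eq1.
- by constructor 3; rewrite invrK.
- by constructor 2; apply: invr_inj.
Qed.

End Conjugacies.

(** * Traces, eigenvalues, multipliers and conjugacy: the cycle of implications *)

(** The order of [R[i]] compares only numbers with equal imaginary parts, so the two inequalities
    already force [t] to be real. *)
Lemma real_segmentP (R : realType) (t : R[i]) :
  [set a%:C%C | a in [set a : R | -2 <= a <= 2]] t <-> -2 <= t <= 2.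
Proof.
have c2 : 2 = 2%:C%C :> R[i] by rewrite rmorph_nat.
split=> [[a /= a2 <-]|/andP[t1 t2]].
  by rewrite c2 -rmorphN !lecR.
have tr : t \is Num.real by rewrite (ger_real t1) rpredN realn.
exists (complex.Re t); last by rewrite RRe_real.
rewrite /= -[t]RRe_real // c2 -?rmorphN !lecR in t1 t2; exact/andP.
Qed.

Lemma trace_to_eigenvalues (C : numClosedFieldType) (Mf Mg : 'M[C]_2) :
  \det Mf = 1 -> \det Mg = 1 ->
  (~ (-2 <= \tr Mf <= 2) /\ ~ (-2 <= \tr Mg <= 2))
    \/ (\tr Mf = \tr Mg \/ \tr Mf = - \tr Mg) ->
  forall l l', eigenvalue Mf l -> eigenvalue Mg l' ->
    [\/ `|l| != 1 /\ `|l'| != 1, l = l' \/ l = - l' | l = l'^* \/ l = - l'^* ].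
Proof.
move=> df dg H l l'; rewrite !eigenvalue2 df dg => /eqP el /eqP el'.
case: H => [[tf tg]|tt].
  by constructor 1;
    rewrite (unimodular_root_trace el) (unimodular_root_trace el'); split;
    apply/negP.
have [e [e1 te]] : exists e : C, (e = 1 \/ e = -1) /\ \tr Mg = e * \tr Mf.
  case: tt => ->; first by exists 1; rewrite mul1r; split=> //; left.
  by exists (-1); rewrite mulN1r opprK; split=> //; right.
have e2 : e * e = 1 by case: e1 => ->; ring.
have l0 : l != 0.
  by apply: contra_eqN el => /eqP ->; rewrite expr0n mulr0 subr0 add0r oner_eq0.
have [|n1] := eqVneq `|l| 1 => [l1|].
  have lV : l^-1 = l^* by rewrite invC_norm l1 expr1n invr1 mul1r.
  (* The roots of the characteristic polynomial of [Mg] are e l and e/l, since their sum is e times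
     the trace of [Mf] and their product is e^2 = 1. *)
  have : (l' - e * l) * (l' - e * l^-1) = 0.
    transitivity (l' ^+ 2 - e * ((l ^+ 2 + 1) / l) * l' + e * e);
      first by field.
    rewrite (_ : l ^+ 2 + 1 = \tr Mf * l); last by apply/eqP;
      rewrite -subr_eq0 -el; apply/eqP; ring.
    by rewrite mulfK // -te e2.
  move/eqP; rewrite mulf_eq0 !subr_eq0 lV => /orP[]/eqP ->.
    by constructor 2; case: e1 => ->; [left|right];
      rewrite ?mul1r ?mulN1r ?opprK.
  constructor 3; case: e1 => ->; [left|right];
    rewrite ?mul1r ?mulN1r ?rmorphN /= conjCK //.
  by rewrite opprK.
constructor 1; split=> //.
rewrite (unimodular_root_trace el').
have : `|l| != 1 by [].
rewrite (unimodular_root_trace el) te; case: e1 => ->;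
  rewrite ?mul1r ?mulN1r //.
(* The segment is symmetric around 0, so a change of sign of the trace does not affect
   membership. *)
by rewrite lerN2 lerNl andbC.
Qed.

(** Each multiplier is the square of a suitable eigenvalue, and squaring absorbs the signs in the
    eigenvalue condition. *)
Lemma eigenvalues_to_multipliers (C : numClosedFieldType)
    (f g : sphere C -> sphere C) (Mf Mg : 'M[C]_2) :
  mobius_matrix f Mf -> mobius_matrix g Mg ->
  (forall l l', eigenvalue Mf l -> eigenvalue Mg l' ->
    [\/ `|l| != 1 /\ `|l'| != 1, l = l' \/ l = - l' | l = l'^* \/ l = - l'^* ]) ->
  forall mu nu, multiplier f mu -> multiplier g nu ->
    [\/ `|mu| != 1 /\ `|nu| != 1, mu = nu | mu = nu^*].
Proof.
move=> hf hg H mu nu /(multiplier_tr hf)[mu0 emu] /(multiplier_tr hg)[nu0 enu].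
have [l <- el] := multiplier_root emu; have [l' <- el'] := multiplier_root enu.
have := H l l';
  rewrite !eigenvalue2 (mobius_matrix_det hf) (mobius_matrix_det hg).
rewrite el el' eqxx => /(_ isT isT) [[n1 n2]|[]->|[]->].
- by constructor 1; rewrite !normrX !pexpr_eq1.
- by constructor 2.
- by constructor 2; rewrite sqrrN.
- by constructor 3; rewrite rmorphXn.
- by constructor 3; rewrite sqrrN rmorphXn.
Qed.

Lemma conjugate_to_trace (R : realType)
    (f g : sphere (Cx R) -> sphere (Cx R)) (Mf Mg : 'M[Cx R]_2) :
  is_mobius f -> is_mobius g -> f <> id -> g <> id ->
  mobius_matrix f Mf -> mobius_matrix g Mg ->
  topologically_conjugate f g ->
  (~ (-2 <= \tr Mf <= 2) /\ ~ (-2 <= \tr Mg <= 2))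
    \/ (\tr Mf = \tr Mg \/ \tr Mf = - \tr Mg).
Proof.
move=> f_mob g_mob fid gid hf hg tc.
have [mu mu0 fmu] := multiplier_exists f_mob fid.
have [nu nu0 gnu] := multiplier_exists g_mob gid.
have [_ emu] : mu != 0 /\ _ := multiplier_tr hf (ex_intro _ mu (And3 mu0 fmu (or_introl erefl))).
have [_ enu] : nu != 0 /\ _ := multiplier_tr hg (ex_intro _ nu (And3 nu0 gnu (or_introl erefl))).
have tcm : topologically_conjugate (model_map mu) (model_map nu).
  apply: topologically_conjugate_trans (mobius_conjugate_top gnu).
  apply: topologically_conjugate_trans tc.
  exact/topologically_conjugate_sym/mobius_conjugate_top.
have [[m1 n1]|mn|mn] := conjugate_models mu0 nu0 tcm.
- left; split => t2; [move: m1|move: n1]; rewrite -norm_eq1.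
    by rewrite (multiplier_norm emu t2) eqxx.
  by rewrite (multiplier_norm enu t2) eqxx.
- by right; apply: (multiplier_trace_eq mu0 nu0 emu enu); left.
- by right; apply: (multiplier_trace_eq mu0 nu0 emu enu); right.
Qed.

(** One multiplier of each map is enough: its three alternatives are realized by a spiral, the
    identity and complex conjugation. *)
Lemma multipliers_to_conjugate (R : realType) (f g : sphere (Cx R) -> sphere (Cx R)) :
  is_mobius f -> is_mobius g -> f <> id -> g <> id ->
  (forall mu nu, multiplier f mu -> multiplier g nu ->
    [\/ `|mu| != 1 /\ `|nu| != 1, mu = nu | mu = nu^*]) ->
  topologically_conjugate f g.
Proof.
move=> f_mob g_mob fid gid H.
have [mu mu0 fmu] := multiplier_exists f_mob fid.
have [nu nu0 gnu] := multiplier_exists g_mob gid.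
apply: topologically_conjugate_trans (mobius_conjugate_top fmu) _.
apply: topologically_conjugate_trans (topologically_conjugate_sym (mobius_conjugate_top gnu)).
have [||[]|->|->] := H mu nu.
- by exists mu; split=> //; left.
- by exists nu; split=> //; left.
- by rewrite !norm_eq1; exact: loxodromic_conjugate.
- by exists id, id; split=> //; split=> // z; exact: cvg_id.
- exact/topologically_conjugate_sym/model_map_conj.
Qed.

Theorem theorem1p1 (R : realType)
    (f g : sphere R[i] -> sphere R[i]) (Mf Mg : 'M[R[i]]_2) :
  is_mobius f -> is_mobius g -> f <> id -> g <> id ->
  mobius_matrix f Mf -> mobius_matrix g Mg ->
  let seg : set R[i] := [set a%:C%C | a in [set a : R | -2 <= a <= 2]] in
  [<-> topologically_conjugate f g ;
       (~ seg (\tr Mf) /\ ~ seg (\tr Mg))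
         \/ (\tr Mf = \tr Mg \/ \tr Mf = - \tr Mg) ;
       forall l l' : R[i], eigenvalue Mf l -> eigenvalue Mg l' ->
         [\/ `|l| != 1 /\ `|l'| != 1,
             l = l' \/ l = - l' |
             l = l'^* \/ l = - l'^* ] ;
       forall mu nu : R[i], multiplier f mu -> multiplier g nu ->
         [\/ `|mu| != 1 /\ `|nu| != 1, mu = nu | mu = nu^* ] ].
Proof.
move=> f_mob g_mob fid gid hf hg seg.
tfae.
- move=> tc; have := conjugate_to_trace f_mob g_mob fid gid hf hg tc.
  by case=> [[tf tg]|]; [left; split=> /real_segmentP|right].
- move=> tt.
  apply: (trace_to_eigenvalues (mobius_matrix_det hf) (mobius_matrix_det hg)).
  by case: tt => [[tf tg]|]; [left; split=> /real_segmentP|right].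
- exact: eigenvalues_to_multipliers hf hg.
- exact: multipliers_to_conjugate f_mob g_mob fid gid.
Qed.
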